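(* The Golomb space $\mathbb{N}_\tau$ is topologically rigid: the only homeomorphism $h:\mathbb{N}_\tau\to\mathbb{N}_\tau$ is the identity map.
   Context: $\mathbb{N}=\{1,2,3,\dots\}$ and $\mathbb{N}_0=\{0\}\cup\mathbb{N}$. The Golomb topology $\tau$ on $\mathbb{N}$ is the topology generated by the base consisting of all arithmetic progressions $a+b\mathbb{N}_0=\{a+bn:n\in\mathbb{N}_0\}$ with $a,b\in\mathbb{N}$ coprime; $\mathbb{N}_\tau=(\mathbb{N},\tau)$ is the Golomb space. A topological space is topologically rigid if its homeomorphism group is trivial. *)

(* Defs.v *)
From mathcomp Require Import all_boot.
Set Implicit Arguments.
Unset Strict Implicit.
Unset Printing Implicit Defensive.

Definition posnat := {n : nat | 0 < n}.

Definition arith_prog (a b : nat) (x : posnat) : Prop :=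
  exists n : nat, proj1_sig x = a + b * n.

Definition golomb_basic (a b : nat) : Prop := 0 < a /\ 0 < b /\ coprime a b.

Definition golomb_open (U : posnat -> Prop) : Prop :=
  forall x, U x -> exists a b, golomb_basic a b /\ arith_prog a b x /\
                          (forall y, arith_prog a b y -> U y).

Definition golomb_continuous (f : posnat -> posnat) : Prop :=
  forall U, golomb_open U -> golomb_open (fun x => U (f x)).

Definition golomb_homeomorphism (h : posnat -> posnat) : Prop :=
  exists g : posnat -> posnat,
    (forall x, g (h x) = x) /\ (forall y, h (g y) = y) /\
    golomb_continuous h /\ golomb_continuous g.

(* Main.v *)
Require Import Defs.
From mathcomp Require Import all_boot cyclic zify ring.

(** The closures of neighbourhoods of three points generate a filter, and homeomorphisms
    transport these filters.  The filter of a triple of distinct points is the largest possible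
    exactly when the points are pairwise coprime, so a homeomorphism [h] preserves coprimality
    and induces a bijection [p |-> p'] of the primes with [p %| x] iff [p' %| h x].  The filter of
    [x, p, p^2] encodes the [p]-adic neighbourhoods of [x], so [h] is continuous from the [p]-adic
    to the [p']-adic topology off the multiples of [p].  Hence [h] maps the [p]-adic closure of the
    powers of a prime [q] onto the [p']-adic closure of the powers of [q'].  These closures are
    (traces of) procyclic groups of units; by lifting the exponent and the existence of primes [q]
    with a prescribed [p]-adic valuation of [q - 1] (prime factors of values of cyclotomic
    polynomials), the progressions [1 + p^k N] occur among them, and comparing inclusions
    shows that [h] maps [1 + p^k N] onto [1 + p'^k N]; the prime 2 needs extra care.
    So [h x - 1] arises from [x - 1] by replacing every prime [p] by [p'], and [h x = x] follows by
    strong induction on [x]. *)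

Set Implicit Arguments.
Unset Strict Implicit.
Unset Printing Implicit Defensive.

(** * Lifting the exponent and primes with prescribed valuation *)

Lemma eqmod1 (x d : nat) : 0 < x -> (x == 1 %[mod d]) = (d %| x - 1).
Proof. by move=> x0; rewrite eqn_mod_dvd. Qed.

Lemma expn_gt1 (x n : nat) : 1 < x -> 0 < n -> 1 < x ^ n.
Proof. by move=> x1 n0; rewrite -[X in X < _](exp1n n) ltn_exp2r. Qed.

Lemma eqmod_dvd_trans (x y d m : nat) : d %| m -> x = y %[mod m] -> x = y %[mod d].
Proof. by move=> dm E; rewrite -(modn_dvdm x dm) E modn_dvdm. Qed.

(** Each power is expanded to first order in [y]. The linear coefficient matters because [p] divides
    ['C(p, 2)] for odd [p] but not for [p = 2]. *)
Lemma geom_sum_mod_sqr (y n : nat) :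
  exists c, \sum_(i < n) (1 + y) ^ i = n + 'C(n, 2) * y + c * y ^ 2.
Proof.
have P i : exists c, (1 + y) ^ i = 1 + i * y + c * y ^ 2.
  elim: i => [|i [c E]]; first by exists 0; rewrite expn0; lia.
  by exists (c + i + c * y); rewrite expnS E; ring.
elim: n => [|n [c E]]; first by exists 0; rewrite big_ord0.
have [c' E'] := P n; exists (c + c').
by rewrite big_ord_recr /= E E' binS bin1; ring.
Qed.

Lemma subn1_expn (x n : nat) : x ^ n - 1 = (x - 1) * \sum_(i < n) x ^ i.
Proof.
rewrite -{1}(exp1n n) subn_exp; congr (_ * _).
rewrite (reindex_inj rev_ord_inj) /=; apply: eq_bigr => i _.
by rewrite exp1n muln1; congr (_ ^ _); have := ltn_ord i; lia.
Qed.

(* Least valuation of [x - 1] for which lifting the exponent applies: [4 %| x - 1] if [p = 2]. *)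
Definition lte_exponent (p : nat) := if p == 2 then 2 else 1.

Lemma lte_exponent_gt0 p : 0 < lte_exponent p.
Proof. by rewrite /lte_exponent; case: ifP. Qed.

Lemma logn_expn_prime (p x : nat) : prime p -> 1 < x ->
  p ^ lte_exponent p %| x - 1 -> logn p (x ^ p - 1) = (logn p (x - 1)).+1.
Proof.
move=> pp x1 dv; have p0 := prime_gt0 pp.
rewrite subn1_expn.
have [c E] := geom_sum_mod_sqr (x - 1) p.
rewrite (_ : 1 + (x - 1) = x) in E; last by lia.
(* The term ['C(p, 2) * (x - 1)] is divisible by [p ^ 2]: each factor contributes a [p] if [p] is
   odd, and [x - 1] alone contributes 4 if [p = 2]. *)
have [u Eu] : exists u, \sum_(i < p) x ^ i = p * (1 + p * u).
  move: dv; rewrite /lte_exponent E; case: eqP => [->|/eqP p2].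
    case/dvdnP=> t ->; exists (t + c * t * t * 4); rewrite binn; ring.
  have odp : odd p by case: (even_prime pp) => // E2; rewrite E2 in p2.
  rewrite expn1 bin2odd // => /dvdnP[t ->].
  by exists (p.-1./2 * t + c * t * t); move: (p.-1./2) => h; ring.
rewrite Eu lognM //; last 2 first.
- by lia.
- by nia.
rewrite lognM // (@logn_prime p p) // eqxx (@logn_coprime _ (1 + p * u)) ?addn1 ?addn0 //.
by rewrite prime_coprime // dvdn_addl ?dvdn_mulr // dvdn1; case: eqP pp => // ->.
Qed.

(** The geometric sum is congruent to [n] modulo [p], hence prime to [p]. *)
Lemma logn_expn_coprime (p x n : nat) : prime p -> 1 < x -> 0 < n ->
  ~~ (p %| n) -> p %| x - 1 -> logn p (x ^ n - 1) = logn p (x - 1).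
Proof.
move=> pp x1 n0 pn dv; rewrite subn1_expn.
have [c E] := geom_sum_mod_sqr (x - 1) n.
rewrite (_ : 1 + (x - 1) = x) in E; last by lia.
rewrite E lognM; [|by lia|by lia].
rewrite (@logn_coprime _ (_ + _)) ?addn0 //.
rewrite prime_coprime // -addnA dvdn_addl // dvdn_add //.
  by rewrite dvdn_mull.
by rewrite dvdn_mull // dvdn_mulr.
Qed.

Lemma lift_exponent (p x n : nat) : prime p -> 1 < x -> 0 < n ->
  p ^ lte_exponent p %| x - 1 ->
  logn p (x ^ n - 1) = logn p (x - 1) + logn p n.
Proof.
move=> pp x1 n0 dv.
have [m cm En] := pfactor_coprime pp n0.
have dv1 : p %| x - 1.
  by apply: dvdn_trans dv; rewrite -{1}(expn1 p) dvdn_exp2l // lte_exponent_gt0.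
have m0 : 0 < m by move: n0; rewrite En; case: m {cm En}.
rewrite {1}En; elim: (logn p n) => [|a IH].
  by rewrite expn0 muln1 addn0 logn_expn_coprime // -prime_coprime.
have xx : 1 < x ^ (m * p ^ a).
  by apply: expn_gt1; rewrite // muln_gt0 m0 expn_gt0 prime_gt0.
rewrite expnSr mulnA expnM logn_expn_prime ?IH ?addnS //.
by apply: dvdn_trans dv _; rewrite subn1_expn dvdn_mulr.
Qed.

Lemma solve_mod (a c p : nat) : coprime a p -> exists t, a * t = c %[mod p].
Proof.
move=> co; have /dvdnP[t Et] : a %| chinese a p 0 c.
  by rewrite /dvdn chinese_modl // mod0n.
by exists t; rewrite mulnC -Et chinese_modr.
Qed.

(* [y] lies in the [p]-adic closure of the powers of [x]. *)
Definition pclosure (p x y : nat) : Prop :=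
  forall K, exists2 n, 0 < n & x ^ n = y %[mod p ^ K].

(** Induction on [K]: the exponent found modulo [p ^ K] is corrected by a multiple of a number [m]
    for which [x ^ m - 1] has valuation exactly [K], so that the next [p]-adic digit can be adjusted
    freely. *)
Lemma pclosure_principal (p x y : nat) : prime p -> 1 < x ->
  p ^ lte_exponent p %| x - 1 ->
  y = 1 %[mod p ^ logn p (x - 1)] -> pclosure p x y.
Proof.
move=> pp x1 dv; set l := logn p (x - 1) => Ey.
have x10 : 0 < x - 1 by lia.
have lle : lte_exponent p <= l by rewrite /l -pfactor_dvdn.
have l0 : 0 < l by apply: leq_trans lle; rewrite lte_exponent_gt0.
have Ex : x = 1 %[mod p ^ l].
  by apply/eqP; rewrite eqmod1 ?pfactor_dvdnn //; lia.
have p0 := prime_gt0 pp.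
elim=> [|K [n n0 En]]; first by exists 1; rewrite // expn0 !modn1.
case: (ltnP K l) => Kl.
  exists 1 => //; rewrite expn1; apply: (@eqmod_dvd_trans _ _ _ (p ^ l)).
    by rewrite dvdn_exp2l.
  by rewrite Ex Ey.
have K0 : 0 < K by apply: leq_trans Kl.
set m := p ^ (K - l); have m0 : 0 < m by rewrite expn_gt0 p0.
have Lz : logn p (x ^ m - 1) = K.
  by rewrite lift_exponent // pfactorK // -/l; lia.
have xm : 1 < x ^ m by apply: expn_gt1.
have [u cu Eu] : exists2 u, coprime p u & x ^ m = 1 + p ^ K * u.
  have [|u cu Eu] := @pfactor_coprime p (x ^ m - 1) pp; first by rewrite subn_gt0.
  by exists u => //; rewrite [p ^ K * u]mulnC -[K in p ^ K]Lz -Eu subnKC // ltnW.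
have zt t : exists c, (1 + p ^ K * u) ^ t = 1 + t * p ^ K * u + c * p ^ K.+1.
  elim: t => [|t [c Et]]; first by exists 0; rewrite expn0; lia.
  exists (c + t * u * u * p ^ (K - 1) + c * p ^ K * u).
  rewrite expnS Et expnS.
  have -> : p ^ K = p * p ^ (K - 1) by rewrite -expnS subn1 prednK.
  ring.
have cw : coprime p (x ^ n).
  rewrite coprimeXr // prime_coprime // -(subnK (ltnW x1)) dvdn_addr.
    by rewrite dvdn1; case: eqP pp => // ->.
  by apply: dvdn_trans dv; rewrite -{1}(expn1 p) dvdn_exp2l // lte_exponent_gt0.
have [y' Ey' wy] : exists2 y', y' = y %[mod p ^ K.+1] & x ^ n <= y'.
  exists (y + x ^ n * p ^ K.+1); first by rewrite addnC modnMDl.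
  by rewrite (leq_trans _ (leq_addl _ _)) // leq_pmulr // expn_gt0 p0.
have /dvdnP[c Ec] : p ^ K %| y' - x ^ n.
  rewrite -eqn_mod_dvd // En; apply/eqP; apply: eqmod_dvd_trans Ey'.
  by rewrite dvdn_exp2l.
have [t Et] : exists t, x ^ n * u * t = c %[mod p].
  by apply: solve_mod; rewrite coprime_sym coprimeMr cw.
exists (n + m * t); first by rewrite addn_gt0 n0.
have [c' Ec'] := zt t.
rewrite -Ey' expnD expnM Eu Ec'.
have -> : y' = x ^ n + c * p ^ K by rewrite -Ec subnKC.
rewrite (_ : x ^ n * _ = x ^ n + x ^ n * u * t * p ^ K + (x ^ n * c') * p ^ K.+1);
  last by ring.
rewrite [X in X %% _]addnC modnMDl.
apply/eqP; rewrite eqn_modDl expnS -!muln_modl; apply/eqP.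
by rewrite Et.
Qed.

Lemma expn_gcd_mod1 (a m n d : nat) : 0 < m ->
  a ^ m = 1 %[mod d] -> a ^ n = 1 %[mod d] -> a ^ gcdn m n = 1 %[mod d].
Proof.
move=> m0 Em En; have [c _ /dvdnP[t Et]] := Bezoutl n m0.
have : a ^ (gcdn m n + c * n) = 1 %[mod d].
  by rewrite Et mulnC expnM -modnXm Em modnXm exp1n.
by rewrite expnD [c * n]mulnC expnM -modnMmr -modnXm En modnXm exp1n modnMmr muln1.
Qed.

(** The first two congruence hypotheses say that [a] has order exactly [p ^ k.+1] modulo [d]. *)
Lemma dvdn_order_pfactor (a p k d m : nat) : prime p ->
  a ^ (p ^ k.+1) = 1 %[mod d] -> a ^ (p ^ k) <> 1 %[mod d] ->
  a ^ m = 1 %[mod d] -> p ^ k.+1 %| m.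
Proof.
move=> pp E1 E2 Em.
have p0 : 0 < p ^ k.+1 by rewrite expn_gt0 prime_gt0.
have := expn_gcd_mod1 p0 E1 Em.
have /(dvdn_pfactor _ _ pp)[j jk Ej] : gcdn (p ^ k.+1) m %| p ^ k.+1 by apply: dvdn_gcdl.
move: jk; rewrite leq_eqVlt => /orP[/eqP Ejk|jk]; first by rewrite -Ejk -Ej dvdn_gcdr.
rewrite Ej => Eg; case: E2.
by rewrite -(subnKC (jk : j <= k)) expnD expnM -modnXm Eg modnXm exp1n.
Qed.

Lemma fermat_little_mod (p a : nat) : prime p -> ~~ (p %| a) -> a ^ (p - 1) = 1 %[mod p].
Proof.
move=> pp pa; rewrite subn1 -totient_prime //; apply: Euler_exp_totient.
by rewrite coprime_sym prime_coprime.
Qed.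

Lemma eqmod1_primes (N d : nat) : 0 < N ->
  (forall q, prime q -> q %| N -> q = 1 %[mod d]) -> N = 1 %[mod d].
Proof.
elim/ltn_ind: N => N IH N0 H.
case: (ltnP 1 N) => N1; last by have -> : N = 1 by lia.
have pq := pdiv_prime N1; have /dvdnP[M EM] := pdiv_dvd N.
have M0 : 0 < M by move: N0; rewrite EM; case: M {EM}.
rewrite EM -modnMmr (H _ pq (pdiv_dvd N)) modnMmr muln1; apply: IH => //.
  by rewrite [X in _ < X]EM ltn_Pmulr // prime_gt1.
by move=> q qp qM; apply: H => //; rewrite EM dvdn_mulr.
Qed.

(** If every prime factor of [N] were 1 modulo [p ^ k.+1], so would be their product [N]; a factor
    that is not has the required valuation. *)
Lemma exists_prime_factor_logn (p k N : nat) : prime p -> 0 < N ->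
  (forall q, prime q -> q %| N -> p ^ k %| q - 1) -> N <> 1 %[mod p ^ k.+1] ->
  exists2 q, prime q & logn p (q - 1) = k.
Proof.
move=> pp N0 H E.
case: (boolP (all (fun q => q == 1 %[mod p ^ k.+1]) (primes N))) => [/allP al|].
  case: E; apply: eqmod1_primes => // q pq qN; apply/eqP/al.
  by rewrite mem_primes pq N0.
case/allPn => q; rewrite mem_primes => /and3P[pq _ qN] ne.
have q10 : 0 < q - 1 by have := prime_gt1 pq; lia.
exists q => //; apply/eqP; rewrite eqn_leq -!pfactor_dvdn // ?H // andbT.
by rewrite leqNgt -pfactor_dvdn // -eqmod1 ?ne // prime_gt0.
Qed.

Lemma prime_ndvd1 p : prime p -> (p %| 1) = false.
Proof. by move=> pp; rewrite dvdn1; case: eqP pp => // ->. Qed.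

Lemma dvdn_geom_sum (p r x : nat) : prime p -> prime r -> 0 < x ->
  r %| \sum_(i < p) x ^ i -> r %| x - 1 -> r = p.
Proof.
move=> pp pr x0 H rx.
have [c E] := geom_sum_mod_sqr (x - 1) p.
have Ex : 1 + (x - 1) = x by lia.
rewrite Ex in E.
move: H; rewrite E -addnA dvdn_addl; first by rewrite dvdn_prime2 // => /eqP.
by rewrite dvdn_add // ?dvdn_mull // dvdn_mulr.
Qed.

(* [q] is a prime factor of the [p ^ k.+1]-th cyclotomic polynomial at [p - 1]. *)
Lemma exists_prime_logn_odd (p k : nat) : prime p -> odd p ->
  exists2 q, prime q & logn p (q - 1) = k.+1.
Proof.
move=> pp op; have p1 := prime_gt1 pp.
have p2 : 2 < p by move: p1 op; case: p {pp} => [|[|[|]]].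
set Q := (p - 1) ^ (p ^ k); set N := \sum_(i < p) Q ^ i.
have Q0 : 0 < Q by rewrite expn_gt0; lia.
have Qe0 n : 0 < Q ^ n by rewrite expn_gt0 Q0.
have QN : Q ^ p - 1 = (Q - 1) * N by rewrite -subn1_expn.
(* The base [p - 1] is chosen because [(p - 1) ^ 2 - 1] has valuation exactly 1, so that lifting the
   exponent determines the valuation of [Q ^ (p - 1) - 1]. *)
have sq : (p - 1) ^ 2 - 1 = p * (p - 2) by rewrite -mulnn; nia.
have N0 : 0 < N.
  by rewrite /N (bigD1 (Ordinal (ltnW p1))) //= expn0.
have l0 : lte_exponent p = 1 by rewrite /lte_exponent; case: eqP => // Ep; rewrite Ep in p2.
have lsq : logn p ((p - 1) ^ 2 - 1) = 1.
  rewrite sq lognM // ?(@logn_prime p p) // ?eqxx ?(@logn_coprime p (p - 2)) //; try lia.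
  by rewrite prime_coprime // gtnNdvd //; lia.
have ev : 2 * (p - 1)./2 = p - 1.
  by rewrite mul2n even_halfK // oddB ?op // ltnW.
have h0 : 0 < (p - 1)./2 by lia.
have lgt : 1 < (p - 1) ^ 2 by rewrite -mulnn; nia.
have L : logn p (Q ^ (p - 1) - 1) = k.+1.
  have -> : Q ^ (p - 1) = ((p - 1) ^ 2) ^ (p ^ k * (p - 1)./2).
    by rewrite /Q -!expnM mulnCA ev.
  rewrite lift_exponent //; last 2 first.
  - by rewrite muln_gt0 expn_gt0 (prime_gt0 pp).
  - by rewrite l0 expn1 sq dvdn_mulr.
  rewrite lsq lognM ?expn_gt0 ?(prime_gt0 pp) //.
  rewrite pfactorK // (@logn_coprime p) ?addn0 ?add1n //.
  by rewrite prime_coprime // gtnNdvd //; lia.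
have pQ : ~~ (p %| Q).
  by rewrite Euclid_dvdX // negb_and gtnNdvd //; lia.
have QmE : Q = p - 1 %[mod p].
  rewrite /Q; elim: (k) => [|j IH]; first by rewrite expn0 expn1.
  by rewrite expnSr expnM -modnXm IH modnXm fermat_little.
have pQ1 : ~~ (p %| Q - 1).
  rewrite -eqmod1 //; apply/negP => /eqP.
  by rewrite QmE !modn_small //; lia.
apply: (@exists_prime_factor_logn p k.+1 N) => //.
  move=> q pq qN.
  have neqp : q <> p.
    move=> Eq; move: qN; rewrite Eq => pN.
    have : p %| Q ^ p - 1 by rewrite QN dvdn_mull.
    by rewrite -eqmod1 ?Qe0 // fermat_little // eqmod1 // (negbTE pQ1).
  have nq1 : ~~ (q %| Q - 1).
    by apply/negP => /(dvdn_geom_sum pp pq Q0 qN).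
  have Eqp : q %| Q ^ p - 1 by rewrite QN dvdn_mull.
  have qQ : ~~ (q %| p - 1).
    apply/negP => qp1; move: Eqp; rewrite -eqmod1 ?Qe0 //.
    have : q %| Q ^ p by rewrite !Euclid_dvdX // qp1 /= expn_gt0 prime_gt0 //= prime_gt0.
    by rewrite /dvdn => /eqP ->; rewrite modn_small ?prime_gt1.
  apply: (@dvdn_order_pfactor (p - 1) p k q) => //.
  - by apply/eqP; rewrite expnSr expnM -/Q eqmod1 // Qe0.
  - by move/eqP; rewrite -/Q eqmod1 // (negbTE nq1).
  - exact: fermat_little_mod.
(* As [Q * (Q ^ (p - 1) - 1) = (Q - 1) * (N - 1)], a factor [p ^ k.+2] of [N - 1] contradicts
   [L]. *)
move/eqP; rewrite eqmod1 // => dN.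
have : p ^ k.+2 %| Q ^ (p - 1) - 1.
  have co : coprime (p ^ k.+2) Q by rewrite coprimeXl // prime_coprime.
  rewrite -(Gauss_dvdr _ co) mulnBr muln1 -expnS subn1 prednK; last by lia.
  have -> : Q ^ p - Q = (Q - 1) * (N - 1) by rewrite mulnBr -QN muln1 subnBA // subnK.
  by rewrite dvdn_mull.
have Q1 : 1 < Q by move: pQ1 Q0; case: (Q) => [|[|]] //; rewrite dvdn0.
have Qe : 1 < Q ^ (p - 1) by apply: expn_gt1; rewrite // subn_gt0.
by rewrite pfactor_dvdn ?L ?ltnn // subn_gt0.
Qed.

(* [q] is a prime factor of [(3 ^ 2 ^ k.+1 + 1) / 2]. *)
Lemma exists_prime_logn2 (k : nat) : exists2 q, prime q & logn 2 (q - 1) = k.+2.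
Proof.
set Q := 3 ^ (2 ^ k.+1).
have Q9 : Q = (3 ^ 2) ^ (2 ^ k) by rewrite -expnM -expnS.
have Q1 : 1 < Q by apply: expn_gt1; rewrite // expn_gt0.
have L : logn 2 (Q - 1) = k.+3.
  by rewrite Q9 lift_exponent ?expn_gt0 // pfactorK // addnC addn3.
have /dvdnP[t Et] : 2 ^ k.+3 %| Q - 1 by rewrite pfactor_dvdn ?L // subn_gt0.
set N := 1 + t * 2 ^ k.+2.
have EN : Q + 1 = 2 * N.
  have : Q = 1 + t * 2 ^ k.+3 by rewrite -Et subnKC // ltnW.
  by rewrite /N expnS; move: (t) (2 ^ k.+2) => u v ->; ring.
apply: (@exists_prime_factor_logn 2 k.+2 N) => //.
  move=> q pq qN.
  have q2 : q <> 2.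
    by move=> E; move: qN; rewrite E /N dvdn_addl // expnS mulnCA dvdn_mulr.
  have qQ : q %| Q + 1 by rewrite EN dvdn_mull.
  apply: (@dvdn_order_pfactor 3 2 k.+1 q) => //.
  - apply/eqP; rewrite expnSr expnM -/Q eqmod1 ?expn_gt0 ?(ltnW Q1) //.
    have -> : Q ^ 2 - 1 = (Q - 1) * (Q + 1) by rewrite -mulnn; nia.
    by rewrite dvdn_mull.
  - move/eqP; rewrite -/Q eqmod1 ?(ltnW Q1) // => H.
    have : q %| (Q + 1) - (Q - 1) by rewrite dvdn_sub.
    have -> : Q + 1 - (Q - 1) = 2 by lia.
    by rewrite dvdn_prime2 // => /eqP.
  - apply: fermat_little_mod => //; rewrite dvdn_prime2 //; apply/eqP => E3.
    move: qQ; rewrite E3 dvdn_addr ?prime_ndvd1 //.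
    by rewrite Euclid_dvdX //= expn_gt0.
(* [N - 1] is half of [Q - 1], whose valuation is given by [L]. *)
move/eqP; rewrite eqmod1 // /N addnC addnK => H.
have : 2 ^ k.+3 * 2 %| Q - 1.
  rewrite Et [2 ^ k.+3 * 2]mulnC [2 ^ k.+3 in X in _ %| X]expnS mulnCA dvdn_pmul2l //.
by rewrite -expnSr pfactor_dvdn ?L ?ltnn // subn_gt0.
Qed.

Lemma exists_prime_logn (p k : nat) : prime p -> lte_exponent p <= k ->
  exists2 q, prime q & logn p (q - 1) = k.
Proof.
move=> pp; rewrite /lte_exponent; case: eqP => [->|/eqP p2].
  by case: k => [|[|k]] // _; apply: exists_prime_logn2.
case: k => // k _; apply: exists_prime_logn_odd => //.
by case: (even_prime pp) => // E2; rewrite E2 in p2.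
Qed.

(** Any prime factor [r] of [1 + q + ... + q ^ (ell - 1)] works: it divides [q ^ ell - 1], and
    dividing [q - 1] would force [r = ell]. It divides neither [q] nor [q - 1], one of which is
    even, so it is odd. *)
Lemma exists_prime_order (ell q : nat) : prime ell -> 1 < q -> ~~ (ell %| q - 1) ->
  exists r, [/\ prime r, r != 2, ~~ (r %| q) &
    forall m, (q ^ m == 1 %[mod r]) = (ell %| m)].
Proof.
move=> pl q1 nl; set N := \sum_(i < ell) q ^ i.
have q0 := ltnW q1.
have N1 : 1 < N.
  rewrite /N; case: ell pl {nl N} => [|[|l]] // _.
  by rewrite big_ord_recl big_ord_recl expn0 expn1 addnA; lia.
have QN : q ^ ell - 1 = (q - 1) * N by rewrite -subn1_expn.
have pr := pdiv_prime N1; have rN := pdiv_dvd N; set r := pdiv N in pr rN.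
have rq : r %| q ^ ell - 1 by rewrite QN dvdn_mull.
have nrq : ~~ (r %| q).
  apply/negP => rq0; move: rq; rewrite -eqmod1 ?expn_gt0 ?q0 //.
  have : r %| q ^ ell by rewrite Euclid_dvdX // rq0 prime_gt0.
  by rewrite /dvdn => /eqP ->; rewrite modn_small ?prime_gt1.
have neq : ~~ (r %| q - 1).
  by apply/negP => H; have Er := dvdn_geom_sum pl pr q0 rN H; rewrite -Er H in nl.
exists r; split => //.
  by apply/eqP => E2; move: nrq neq; rewrite E2; lia.
move=> m; apply/eqP/idP => [Em|/dvdnP[t ->]].
  rewrite -(expn1 ell); apply: (@dvdn_order_pfactor q ell 0 r) => //.
  - by apply/eqP; rewrite expn1 eqmod1 // expn_gt0 q0.
  - by move/eqP; rewrite expn0 expn1 eqmod1 // (negbTE neq).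
rewrite mulnC expnM -modnXm.
have /eqP -> : q ^ ell == 1 %[mod r] by rewrite eqmod1 // expn_gt0 q0.
by rewrite modnXm exp1n.
Qed.

(** * Transfer of closures of powers *)

Lemma expn_mod1 (x n d : nat) : x = 1 %[mod d] -> x ^ n = 1 %[mod d].
Proof. by move=> E; rewrite -modnXm E modnXm exp1n. Qed.

Lemma pclosure_refl (p x : nat) : pclosure p x x.
Proof. by move=> K; exists 1; rewrite ?expn1. Qed.

Lemma pclosure_trans (p x y z : nat) :
  pclosure p x y -> pclosure p y z -> pclosure p x z.
Proof.
move=> xy yz K; have [n n0 En] := xy K; have [m m0 Em] := yz K.
by exists (n * m); rewrite ?muln_gt0 ?n0 // expnM -modnXm En modnXm.
Qed.

Lemma pclosure_power (p x n : nat) : 0 < n -> pclosure p x (x ^ n).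
Proof. by move=> n0 K; exists n. Qed.

Lemma pclosure_ndvd (p x y : nat) : prime p -> ~~ (p %| x) -> pclosure p x y -> ~~ (p %| y).
Proof.
move=> pp px /(_ 1)[n n0]; rewrite expn1 => E; apply: contra px => py.
have : p %| x ^ n by rewrite /dvdn E.
by rewrite Euclid_dvdX // n0 andbT.
Qed.

Lemma pclosure_mod1 (p k x y : nat) :
  x = 1 %[mod p ^ k] -> pclosure p x y -> y = 1 %[mod p ^ k].
Proof. by move=> Ex /(_ k)[n _ <-]; apply: expn_mod1. Qed.

(** Closures of powers are groups: by Euler's theorem [x ^ (a * t.-1)] inverts [x ^ a] modulo
    [p ^ K]. *)
Lemma pclosure_quotient (p x u v : nat) : prime p -> ~~ (p %| x) ->
  pclosure p x u -> pclosure p x (u * v) -> pclosure p x v.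
Proof.
move=> pp px xu xuv K; have [a a0 Ea] := xu K; have [b b0 Eb] := xuv K.
set t := totient (p ^ K).
have t0 : 0 < t by rewrite totient_gt0 expn_gt0 prime_gt0.
have Et : x ^ t = 1 %[mod p ^ K].
  by apply: Euler_exp_totient; rewrite coprime_sym coprimeXl // prime_coprime.
exists (b + a * t.-1); first by rewrite addn_gt0 b0.
have E : u * x ^ (a * t.-1) = 1 %[mod p ^ K].
  rewrite -modnMml -Ea modnMml -expnD -mulnS prednK // mulnC expnM.
  exact: expn_mod1.
by rewrite expnD -modnMml Eb modnMml mulnAC -modnMml E modnMml mul1n.
Qed.

Lemma pclosure_principalP (p x y : nat) : prime p -> 1 < x ->
  p ^ lte_exponent p %| x - 1 ->
  pclosure p x y <-> y = 1 %[mod p ^ logn p (x - 1)].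
Proof.
move=> pp x1 dv; split; last exact: pclosure_principal.
apply: pclosure_mod1; apply/eqP; rewrite eqmod1 ?(ltnW x1) //.
by rewrite pfactor_dvdn ?subn_gt0.
Qed.

Lemma logn_sub1_neq (p q : nat) : prime p -> 0 < logn p (q - 1) -> p <> q.
Proof.
by move=> pp H E; move: H; rewrite -E logn_coprime // subn1 coprimenP ?prime_gt0.
Qed.

Definition corresponding (f : nat -> nat) (p r : nat) : Prop :=
  [/\ prime p, prime r & forall z, 0 < z -> (p %| z) = (r %| f z)].

(* What is kept of a homeomorphism [f] with inverse [g]; values at 0 are irrelevant. *)
Record arith_homeo (f g : nat -> nat) : Prop := ArithHomeo {
  arith_homeo_gt0 : forall x, 0 < x -> 0 < f x;
  arith_homeo_can : forall x, 0 < x -> g (f x) = x;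
  arith_homeo_prime : forall p, prime p -> exists r, corresponding f p r;
  arith_homeo_cont : forall p r, corresponding f p r ->
    forall y, 0 < y -> ~~ (p %| y) -> forall K, exists L, forall x, 0 < x ->
      x = y %[mod p ^ L] -> f x = f y %[mod r ^ K] }.

Section Correspondence.
Variables (f g : nat -> nat).
Hypotheses (fg : arith_homeo f g) (gf : arith_homeo g f).

Let f0 x : 0 < x -> 0 < f x. Proof. exact: (arith_homeo_gt0 fg). Qed.
Let g0 x : 0 < x -> 0 < g x. Proof. exact: (arith_homeo_gt0 gf). Qed.
Let fK x : 0 < x -> g (f x) = x. Proof. exact: (arith_homeo_can fg). Qed.
Let gK x : 0 < x -> f (g x) = x. Proof. exact: (arith_homeo_can gf). Qed.

Lemma corresponding_sym p r : corresponding f p r -> corresponding g r p.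
Proof. by case=> pp pr H; split=> // z z0; rewrite -{1}(gK z0) -H // g0. Qed.

Lemma corresponding_inj p r r' : corresponding f p r -> corresponding f p r' -> r = r'.
Proof.
move=> [pp pr H] [_ pr' H']; have r0 := prime_gt0 pr.
have : r' %| f (g r) by rewrite -H' ?g0 // H ?g0 // gK.
by rewrite gK // dvdn_prime2 // => /eqP.
Qed.

(** A prime [s] dividing [f (q ^ n)] corresponds to a prime dividing [q ^ n], that is to [q], so
    [s = r]. *)
Lemma corresponding_power q r n : corresponding f q r -> 0 < n ->
  exists2 m, 0 < m & f (q ^ n) = r ^ m.
Proof.
move=> qr n0; have [pq pr H] := qr.
have x0 : 0 < q ^ n by rewrite expn_gt0 prime_gt0.
have : r.-nat (f (q ^ n)).
  apply/pnatP; rewrite ?f0 // => s ps sf; have [p sp] := arith_homeo_prime gf ps.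
  case: (sp) => _ pp Hp; move: sf; rewrite Hp ?f0 // fK // Euclid_dvdX // n0 andbT.
  rewrite dvdn_prime2 // => /eqP Ep; rewrite -Ep in qr.
  rewrite inE /=; apply/eqP.
  have ps' : corresponding f p s.
    by split=> // z z0; rewrite Hp ?f0 // fK.
  exact: (corresponding_inj ps' qr).
case/p_natP => m Em; exists m => //.
case: m Em => // Em; have := H _ x0.
by rewrite Em expn0 (prime_ndvd1 pr) Euclid_dvdX // dvdnn n0.
Qed.

(** Powers of [q] go to powers of [q'], and continuity at [y] carries the approximation over;
    [p <> q] makes [y] prime to [p], where continuity is available. *)
Lemma pclosure_image p p' q q' y : corresponding f p p' -> corresponding f q q' ->
  p <> q -> 0 < y -> pclosure p q y -> pclosure p' q' (f y).
Proof.
move=> pp' qq' npq y0 H K; have [pp _ _] := pp'; have [pq _ _] := qq'.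
have npdq : ~~ (p %| q) by rewrite dvdn_prime2 //; apply/eqP.
have [L HL] := arith_homeo_cont fg pp' y0 (pclosure_ndvd pp npdq H) K.
have [n n0 En] := H L; have [m m0 Em] := corresponding_power qq' n0.
by exists m; rewrite // -Em; apply: HL; rewrite // expn_gt0 prime_gt0.
Qed.

End Correspondence.

Section ClosureTransfer.
Variables (f g : nat -> nat).
Hypotheses (fg : arith_homeo f g) (gf : arith_homeo g f).

Let f0 x : 0 < x -> 0 < f x. Proof. exact: (arith_homeo_gt0 fg). Qed.
Let g0 x : 0 < x -> 0 < g x. Proof. exact: (arith_homeo_gt0 gf). Qed.
Let fK x : 0 < x -> g (f x) = x. Proof. exact: (arith_homeo_can fg). Qed.
Let gK x : 0 < x -> f (g x) = x. Proof. exact: (arith_homeo_can gf). Qed.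
Let csym p r : corresponding f p r -> corresponding g r p.
Proof. exact: (corresponding_sym gf). Qed.
Let csym' p r : corresponding g p r -> corresponding f r p.
Proof. exact: (corresponding_sym fg). Qed.

Lemma corresponding_neq p r q s : corresponding f p r -> corresponding f q s ->
  p <> q -> r <> s.
Proof.
move=> pr qs npq E; rewrite -E in qs; apply: npq.
exact: (corresponding_inj fg (csym pr) (csym qs)).
Qed.

Lemma exists_preimage r : prime r -> exists p, corresponding f p r.
Proof. by move=> pr; have [p /csym'] := arith_homeo_prime gf pr; exists p. Qed.

Lemma pclosure_imageP p p' q q' y : corresponding f p p' -> corresponding f q q' ->
  p <> q -> 0 < y -> pclosure p q y <-> pclosure p' q' (f y).
Proof.
move=> pp' qq' npq y0; split; first exact: (pclosure_image fg gf pp' qq' npq y0).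
move/(pclosure_image gf fg (csym pp') (csym qq')
        (corresponding_neq pp' qq' npq) (f0 y0)).
by rewrite fK.
Qed.

(* The prime [r] is chosen so that [q' ^ m = 1 %[mod r]] exactly when [ell] divides [m]; the
   set of such powers is [f]-definable because [1 + r N] is the [r]-adic closure of the powers
   of a prime. *)
Lemma pclosure_power_image p p' q q' ell : corresponding f p p' -> corresponding f q q' ->
  p <> q -> prime ell -> ~~ (ell %| q' - 1) ->
  exists2 d, 0 < d & forall y, 0 < y ->
    pclosure p (q ^ d) y <-> pclosure p' (q' ^ ell) (f y).
Proof.
move=> pp' qq' npq pl nl; have [pp pp1 _] := pp'; have [pq pq' Hq] := qq'.
have npq' := corresponding_neq pp' qq' npq.
have [r [pr r2 rq' Hr]] := exists_prime_order pl (prime_gt1 pq') nl.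
have lr : lte_exponent r = 1 by rewrite /lte_exponent (negbTE r2).
(* Valuation exactly 1 makes the powers of [s] dense in [1 + r N] for the [r]-adic topology. *)
have [|s ps Ls] := exists_prime_logn pr (k := 1); first by rewrite lr.
have rs : r <> s by apply: (logn_sub1_neq pr); rewrite Ls.
have [r0 rr] := exists_preimage pr; have [s0 ss] := exists_preimage ps.
have rs0 : r0 <> s0.
  by move=> E; rewrite -E in ss; apply: rs; apply: (corresponding_inj gf rr ss).
have [pr0 _ _] := rr; have [ps0 _ _] := ss.
have qn0 n : 0 < q ^ n by rewrite expn_gt0 prime_gt0.
have HP n : pclosure r0 s0 (q ^ n) <-> f (q ^ n) = 1 %[mod r].
  rewrite (pclosure_imageP rr ss rs0 (qn0 n)).
  rewrite pclosure_principalP ?Ls ?expn1 ?prime_gt1 //.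
  by rewrite lr expn1 -{1}(expn1 r) pfactor_dvdn ?Ls // subn_gt0 prime_gt1.
pose P n := (0 < n) && (f (q ^ n) == 1 %[mod r]).
have PP n : 0 < n -> P n <-> pclosure r0 s0 (q ^ n).
  by move=> n0; rewrite HP /P n0 /=; split=> [/eqP|E] //; apply/eqP.
have exP : exists n, P n.
  have [m m0 Em] := corresponding_power gf fg (csym qq') (prime_gt0 pl).
  exists m; rewrite /P m0 -Em gK ?expn_gt0 ?(prime_gt0 pq') //.
  by rewrite Hr dvdnn.
case: (ex_minnP exP) => d Pd dmin.
have d0 : 0 < d by case/andP: Pd.
have Hd := proj1 (PP d d0) Pd.
(* Division with remainder applies to the exponents satisfying [P] because closures of powers are
   groups. *)
have Pdiv n : 0 < n -> P n -> d %| n.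
  move=> n0 Pn; rewrite /dvdn -leqn0 leqNgt; apply/negP => m0.
  have : d <= n %% d.
    apply: dmin; apply/PP => //.
    case: (posnP (n %/ d)) => [E|t0].
      by have := proj1 (PP n n0) Pn; rewrite {1}(divn_eq n d) E mul0n add0n.
    apply: (@pclosure_quotient _ _ (q ^ (n %/ d * d))) => //.
    - by rewrite dvdn_prime2 //; apply/eqP.
    - by rewrite mulnC expnM; apply: pclosure_trans Hd _; apply: pclosure_power.
    - by rewrite -expnD -divn_eq; apply/PP.
  by rewrite leqNgt ltn_mod d0.
exists d => // y y0; split=> H K.
  have npy : ~~ (p %| y).
    apply: (pclosure_ndvd pp _ H).
    by rewrite Euclid_dvdX // dvdn_prime2 // d0 andbT; apply/eqP.
  have [L HL] := arith_homeo_cont fg pp' y0 npy K.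
  have [n n0 En] := H L; rewrite -expnM in En.
  have dn0 : 0 < d * n by rewrite muln_gt0 d0.
  have [m m0 Em] := corresponding_power fg gf qq' dn0.
  have /andP[_] : P (d * n).
    by apply/PP => //; rewrite expnM; apply: pclosure_trans Hd _; apply: pclosure_power.
  rewrite Em Hr => /dvdnP[t Et]; exists t; first by move: m0; rewrite Et; case: (t).
  by rewrite -expnM mulnC -Et -Em; apply: HL.
have npy : ~~ (p' %| f y).
  apply: (pclosure_ndvd pp1 _ H); rewrite Euclid_dvdX // dvdn_prime2 // prime_gt0 // andbT.
  exact/eqP.
have [L HL] := arith_homeo_cont gf (csym pp') (f0 y0) npy K.
have [n n0 En] := H L; rewrite -expnM in En.
have en0 : 0 < ell * n by rewrite muln_gt0 prime_gt0.
have [m m0 Em] := corresponding_power gf fg (csym qq') en0.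
have qe0 : 0 < q' ^ (ell * n) by rewrite expn_gt0 prime_gt0.
have /(Pdiv m m0)/dvdnP[t Et] : P m by rewrite /P m0 -Em gK // Hr dvdn_mulr.
exists t; first by move: m0; rewrite Et; case: (t).
by rewrite -expnM mulnC -Et -Em -[y in RHS](fK y0); apply: HL.
Qed.
End ClosureTransfer.

(** * Images of the progressions [1 + p^k N] *)

Lemma lte_exponent_le (p k : nat) : p != 2 -> 0 < k -> lte_exponent p <= k.
Proof. by rewrite /lte_exponent => /negbTE ->. Qed.

Lemma eqmod1_logn (p k x : nat) : prime p -> 1 < x ->
  (x == 1 %[mod p ^ k]) = (k <= logn p (x - 1)).
Proof. by move=> pp x1; rewrite eqmod1 ?(ltnW x1) // pfactor_dvdn // subn_gt0. Qed.

Lemma eqmod_pow_leq (p k l x y : nat) : k <= l ->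
  x = y %[mod p ^ l] -> x = y %[mod p ^ k].
Proof. by move=> kl; apply: eqmod_dvd_trans; apply: dvdn_exp2l. Qed.

Lemma pclosure_logn (p x y : nat) : prime p -> 1 < x ->
  lte_exponent p <= logn p (x - 1) ->
  pclosure p x y <-> y = 1 %[mod p ^ logn p (x - 1)].
Proof.
move=> pp x1 H; apply: pclosure_principalP => //.
by rewrite pfactor_dvdn // subn_gt0.
Qed.

(** By Fermat [x := q ^ n] is 1 modulo [p], so taking its [p]-th power raises the valuation of
    [x - 1] by one. That valuation equals the one of [x ^ (p - 1) - 1], a multiple of
    [q ^ (p - 1) - 1]. *)
Lemma expn_prime_mul_mod1 (p q n : nat) : prime p -> p != 2 -> 1 < q -> 0 < n ->
  q ^ (p * n) = 1 %[mod p] ->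
  q ^ (p * n) = 1 %[mod p ^ (logn p (q ^ (p - 1) - 1)).+1].
Proof.
move=> pp p2 q1 n0; rewrite mulnC expnM fermat_little //.
have p1 := prime_gt1 pp.
have x1 : 1 < q ^ n by apply: expn_gt1.
have pm0 : 0 < p - 1 by rewrite subn_gt0.
have z1 : 1 < q ^ (p - 1) by apply: expn_gt1.
have lte1 : lte_exponent p = 1 by rewrite /lte_exponent (negbTE p2).
move/eqP; rewrite eqmod1 ?(ltnW x1) // => dv; apply/eqP.
have xp1 : 1 < (q ^ n) ^ p by apply: expn_gt1; rewrite ?prime_gt0.
rewrite eqmod1_logn // (logn_expn_prime pp x1) ?lte1 ?expn1 // ltnS.
have <- : logn p ((q ^ n) ^ (p - 1) - 1) = logn p (q ^ n - 1).
  by rewrite logn_expn_coprime // gtnNdvd // ltn_subrL (prime_gt0 pp).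
have zx : (q ^ n) ^ (p - 1) = (q ^ (p - 1)) ^ n by rewrite -!expnM mulnC.
rewrite zx; apply: dvdn_leq_log; first by rewrite subn_gt0 expn_gt1.
by rewrite [X in _ %| X]subn1_expn dvdn_mulr.
Qed.

(* All closures of powers inside [1 + p^k N] are comparable, so their images are.  If [q'] were not
   1 mod [p'], the closure of the powers of [q' ^ p'] and the progression [1 + p'^b N], where [b] is
   the valuation of [q' ^ (p' - 1) - 1], would be incomparable images. *)
Lemma image_prime_eqmod1 f g p p' q q' : arith_homeo f g -> arith_homeo g f ->
  corresponding f p p' -> corresponding f q q' -> p' != 2 ->
  lte_exponent p <= logn p (q - 1) -> p' %| q' - 1.
Proof.
move=> fg gf pp' qq' p'2 Lq; apply/negPn/negP => np.
have [prp prp' _] := pp'; have [prq prq' _] := qq'.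
have lq0 : 0 < logn p (q - 1) by apply: leq_trans Lq; apply: lte_exponent_gt0.
have npq := logn_sub1_neq prp lq0.
have npq' := corresponding_neq fg gf pp' qq' npq.
have q1 := prime_gt1 prq; have q'1 := prime_gt1 prq'; have p'1 := prime_gt1 prp'.
have pd : 0 < p' - 1 by rewrite subn_gt0.
set z := q' ^ (p' - 1); have z1 : 1 < z by apply: expn_gt1.
set b := logn p' (z - 1).
have b0 : 0 < b.
  rewrite -eqmod1_logn // expn1; apply/eqP; apply: fermat_little_mod => //.
  by rewrite dvdn_prime2 //; apply/eqP.
have Lb : lte_exponent p' <= b by apply: lte_exponent_le.
have [s' prs' Ls'] := exists_prime_logn prp' Lb; have s'1 := prime_gt1 prs'.
have [s ss'] := exists_preimage fg gf prs'; have [prs _ _] := ss'.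
have s1 := prime_gt1 prs.
have nps' : p' <> s' by apply: (logn_sub1_neq prp'); rewrite Ls'.
have nps : p <> s.
  by move=> E; rewrite -E in ss'; apply: nps'; apply: (corresponding_inj gf pp' ss').
have cls' y : pclosure p' s' y <-> y = 1 %[mod p' ^ b].
  by rewrite -Ls'; apply: pclosure_logn; rewrite ?Ls'.
have clq' y : y = 1 %[mod p' ^ b] -> pclosure p' q' y.
  move=> Ey; apply: (@pclosure_trans _ _ z); first exact: pclosure_power.
  by apply/pclosure_logn.
have clq y : pclosure p q y <-> y = 1 %[mod p ^ logn p (q - 1)] by apply: pclosure_logn.
(* [1 + p'^b N] lies in the closure of the powers of [q']. Pulled back, this puts [s] in the closure
   of the powers of [q], so the powers of [s] also have a progression as closure. *)
have Es : s = 1 %[mod p ^ logn p (q - 1)].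
  apply/clq/(pclosure_imageP fg gf pp' qq' npq (prime_gt0 prs))/clq'.
  have [m m0] := corresponding_power fg gf ss' (n := 1) isT.
  by rewrite expn1 => ->; apply/cls'; apply: pclosure_power.
have Ls : logn p (q - 1) <= logn p (s - 1) by rewrite -eqmod1_logn //; apply/eqP.
have cls y : pclosure p s y <-> y = 1 %[mod p ^ logn p (s - 1)].
  by apply: pclosure_logn => //; apply: leq_trans Ls.
have [d d0 Hd] := pclosure_power_image fg gf pp' qq' npq prp' np.
have qd1 : 1 < q ^ d by apply: expn_gt1.
have Ld : logn p (q ^ d - 1) = logn p (q - 1) + logn p d.
  by rewrite lift_exponent // pfactor_dvdn // subn_gt0.
have cld y : pclosure p (q ^ d) y <-> y = 1 %[mod p ^ logn p (q ^ d - 1)].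
  by apply: pclosure_logn; rewrite // Ld (leq_trans Lq) // leq_addr.
have gp y : 0 < y -> 0 < g y by apply: (arith_homeo_gt0 gf).
have gK y : 0 < y -> f (g y) = y by apply: (arith_homeo_can gf).
have qp0 : 0 < q' ^ p' by rewrite expn_gt0 prime_gt0.
(* The closures of the powers of [q ^ d] and of [s] are nested. One inclusion makes [s'] a limit of
   powers of [q' ^ p'], hence 1 modulo [p' ^ b.+1]; the other makes [q' ^ p'], hence [q'], 1 modulo
   [p']. *)
case/orP: (leq_total (logn p (q ^ d - 1)) (logn p (s - 1))) => [le|le].
  have s'0 := prime_gt0 prs'.
  have : pclosure p (q ^ d) (g s').
    apply/cld; apply: eqmod_pow_leq le _; apply/cls.
    apply/(pclosure_imageP fg gf pp' ss' nps (gp _ s'0)).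
    by rewrite gK //; apply: pclosure_refl.
  move/(Hd _ (gp _ s'0)); rewrite gK // => /(_ b.+1)[n n0]; rewrite -expnM => En.
  have E1 : q' ^ (p' * n) = 1 %[mod p'].
    rewrite -(expn1 p') (@eqmod_pow_leq _ _ _ _ _ _ En) //.
    by apply: (@eqmod_pow_leq _ _ b) => //; apply/cls'/pclosure_refl.
  have := expn_prime_mul_mod1 prp' p'2 q'1 n0 E1.
  by rewrite -/z -/b En => /eqP; rewrite eqmod1_logn // Ls' ltnn.
have : pclosure p' s' (q' ^ p').
  rewrite -[q' ^ p'](gK _ qp0); apply/(pclosure_imageP fg gf pp' ss' nps (gp _ qp0))/cls.
  apply: eqmod_pow_leq le _; apply/cld/(Hd _ (gp _ qp0)).
  by rewrite gK //; apply: pclosure_refl.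
move/cls'/(@eqmod_pow_leq _ 1 _ _ _ b0); rewrite expn1 fermat_little // => /eqP.
by rewrite eqmod1 ?(negbTE np) // ltnW.
Qed.

(** The odd [n] is invertible modulo the power of two [T]. Taking [K.+2] instead of [K] keeps [T]
    even for [K = 0], which excludes [n * m = 0]. *)
Lemma odd_root_mod2 (a n K : nat) : odd a -> odd n ->
  exists2 m, 0 < m & (a ^ n) ^ m = a %[mod 2 ^ K].
Proof.
move=> oa on; set T := totient (2 ^ K.+2).
have ET : T = 2 ^ K.+1 by rewrite /T totient_pfactor // mul1n.
have [m Em] : exists m, n * m = 1 %[mod T].
  by apply: solve_mod; rewrite ET coprimeXr // coprimen2.
have nm0 : 0 < n * m.
  rewrite lt0n; apply/eqP => E; move: Em; rewrite E ET mod0n expnS.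
  by rewrite modn_small // -{1}(muln1 2) leq_mul2l /= expn_gt0.
exists m; first by move: nm0; rewrite muln_gt0 => /andP[].
move: Em => /eqP; rewrite eqmod1 // => /dvdnP[t Et].
have -> : (a ^ n) ^ m = a * (a ^ T) ^ t.
  by rewrite -!expnM -expnS [T * t]mulnC -Et subn1 prednK.
have E : a ^ T = 1 %[mod 2 ^ K].
  apply: (@eqmod_pow_leq _ _ K.+2); first by lia.
  by apply: Euler_exp_totient; rewrite coprimeXr // coprimen2.
by rewrite -modnMmr (expn_mod1 _ E) modnMmr muln1.
Qed.

(* The closures of the powers of 3 and of 5 are 2-adically incomparable. *)
Lemma corresponding2 f g r : arith_homeo f g -> arith_homeo g f ->
  corresponding f 2 r -> r = 2.
Proof.
move=> fg gf c2; apply/eqP/negPn/negP => r2; have [_ prr _] := c2.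
have r1 := prime_gt1 prr.
have [a c3] := arith_homeo_prime fg (isT : prime 3).
have [b c5] := arith_homeo_prime fg (isT : prime 5).
have [_ pra _] := c3; have [_ prb _] := c5.
have a1 := prime_gt1 pra; have b1 := prime_gt1 prb.
have nra : r <> a by apply: (corresponding_neq fg gf c2 c3).
have gp y : 0 < y -> 0 < g y by apply: (arith_homeo_gt0 gf).
have gK y : 0 < y -> f (g y) = y by apply: (arith_homeo_can gf).
have rb : r %| b - 1 by apply: (image_prime_eqmod1 fg gf c2 c5 r2).
have b10 : 0 < b - 1 by rewrite subn_gt0.
have lb : 0 < logn r (b - 1) by rewrite -pfactor_dvdn.
have cl5 y : pclosure 2 5 y <-> y = 1 %[mod 4] by apply: (@pclosure_logn 2 5).
have i5 y : 0 < y -> y = 1 %[mod 4] <-> f y = 1 %[mod r ^ logn r (b - 1)].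
  move=> y0; rewrite -cl5 (pclosure_imageP fg gf c2 c5) //.
  by apply: pclosure_logn => //; apply: lte_exponent_le.
have i3 y : 0 < y -> pclosure 2 3 y <-> pclosure r a (f y).
  by move=> y0; apply: (pclosure_imageP fg gf c2 c3).
(* If [r] divides [a - 1], the closures for [a] and [b] are nested progressions, hence so are those
   for 3 and 5; but 5 is not a power of 3 modulo 8, and 3 is not 1 modulo 4. *)
case: (boolP (r %| a - 1)) => ra.
  have la : 0 < logn r (a - 1) by rewrite -pfactor_dvdn // subn_gt0.
  have cla y : pclosure r a y <-> y = 1 %[mod r ^ logn r (a - 1)].
    by apply: pclosure_logn => //; apply: lte_exponent_le.
  case/orP: (leq_total (logn r (a - 1)) (logn r (b - 1))) => le.
    have /(_ 3)[n _] : pclosure 2 3 5.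
      by apply/i3/cla => //; apply: eqmod_pow_leq le _; apply/i5.
    rewrite (divn_eq n 2) expnD [_ * 2]mulnC expnM -modnMml (@expn_mod1 (3 ^ 2)) // modnMml mul1n.
    by have := ltn_mod n 2; case: (n %% 2) => [|[|]].
  suff : 3 = 1 %[mod 4] by [].
  by apply/i5 => //; apply: eqmod_pow_leq le _; apply/cla/i3 => //; apply: pclosure_refl.
have [//|d d0 Hd] := pclosure_power_image fg gf c2 c3 _ prr ra.
have ar0 : 0 < a ^ r by rewrite expn_gt0 prime_gt0.
(* For odd [d], 3 is a limit of powers of [3 ^ d], so [a] would be a limit of powers of [a ^ r],
   which the valuation of [a ^ (r - 1) - 1] forbids. *)
case: (boolP (odd d)) => od.
  have a0 := prime_gt0 pra.
  have : pclosure r (a ^ r) a.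
    rewrite -[X in pclosure _ _ X](gK _ a0); apply/(Hd _ (gp _ a0)).
    apply: (@pclosure_trans _ _ 3); last first.
      by apply/(i3 _ (gp _ a0)); rewrite gK //; apply: pclosure_refl.
    by move=> K; apply: odd_root_mod2.
  set z := a ^ (r - 1).
  have z1 : 1 < z by apply: expn_gt1; rewrite ?subn_gt0.
  set b0 := logn r (z - 1) => /(_ b0.+1)[n n0]; rewrite -expnM => En.
  have Ez : z = 1 %[mod r].
    by apply: fermat_little_mod; rewrite // dvdn_prime2 //; apply/eqP.
  have : (z ^ r) ^ n = z %[mod r ^ b0.+1].
    by rewrite /z -!expnM [(r - 1) * _]mulnC expnM -modnXm En modnXm.
  have Ezr : z ^ r = 1 %[mod r ^ b0.+1].
    have zr1 : 1 < z ^ r by apply: expn_gt1; rewrite ?prime_gt0.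
    apply/eqP; rewrite eqmod1_logn //.
    rewrite (logn_expn_prime prr z1) // /lte_exponent (negbTE r2) expn1.
    by rewrite -eqmod1 ?(ltnW z1) //; apply/eqP.
  rewrite (expn_mod1 _ Ezr) => /esym/eqP.
  by rewrite eqmod1_logn // ltnn.
(* For even [d], [3 ^ d] and with it [g (a ^ r)] are 1 modulo 4, so [a ^ r] and hence [a] are 1
   modulo [r]. *)
have : pclosure 2 (3 ^ d) (g (a ^ r)).
  by apply/(Hd _ (gp _ ar0)); rewrite gK //; apply: pclosure_refl.
have E3 : 3 ^ d = 1 %[mod 2 ^ 2].
  have /dvdnP[t ->] : 2 %| d by rewrite dvdn2.
  by rewrite mulnC expnM; apply: expn_mod1.
move/(pclosure_mod1 E3)/(i5 _ (gp _ ar0)); rewrite gK //.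
move/(@eqmod_pow_leq _ 1 _ _ _ lb); rewrite expn1 fermat_little // => /eqP.
by rewrite eqmod1 ?(negbTE ra) // ltnW.
Qed.

Lemma odd_sqr_mod8 (a : nat) : odd a -> a ^ 2 = 1 %[mod 8].
Proof.
move=> oa; have oa8 : odd (a %% 8) by rewrite odd_mod.
rewrite -modnXm; move: oa8; have := ltn_mod a 8.
by move: (a %% 8); do 8?[case=> //].
Qed.

(* [q] lies in the closure of the powers of 3, hence [q'] in that of the powers of [a := 3'].  An odd
   exponent would make [a], a limit of powers of [q'], hence 3 one of powers of [q]. *)
Lemma image_prime_eqmod8 f g q q' : arith_homeo f g -> arith_homeo g f ->
  corresponding f 2 2 -> corresponding f q q' ->
  3 <= logn 2 (q - 1) -> q' = 1 %[mod 8].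
Proof.
move=> fg gf c2 cq Lq; apply/eqP/negPn/negP => nq8.
have [prq prq' _] := cq; have q1 := prime_gt1 prq; have q'0 := prime_gt0 prq'.
have n2q : 2 <> q by apply: logn_sub1_neq => //; apply: leq_trans Lq.
have [a c3] := arith_homeo_prime fg (isT : prime 3); have [_ pra _] := c3.
have n2a : 2 <> a by apply: (corresponding_neq fg gf c2 c3).
have oa : odd a by case: (even_prime pra) => // E; case: n2a.
have gp y : 0 < y -> 0 < g y by apply: (arith_homeo_gt0 gf).
have gK y : 0 < y -> f (g y) = y by apply: (arith_homeo_can gf).
have clq y : pclosure 2 q y <-> y = 1 %[mod 2 ^ logn 2 (q - 1)].
  by apply: pclosure_logn => //; apply: leq_trans Lq.
have aq : pclosure 2 a q'.
  rewrite -[q'](gK _ q'0); apply/(pclosure_imageP fg gf c2 c3 _ (gp _ q'0)) => //.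
  apply: (@pclosure_trans _ _ (3 ^ 2)); first exact: pclosure_power.
  apply/pclosure_logn => //; apply: (@eqmod_pow_leq _ 3 _ _ _ Lq); apply/clq.
  apply/(pclosure_imageP fg gf c2 cq n2q (gp _ q'0)).
  by rewrite gK //; apply: pclosure_refl.
have qa : pclosure 2 q' a.
  (* The precision [K + 3] retains the class of [q'] modulo 8, which forces [n] to be odd. *)
  move=> K; have [n n0 En] := aq (K + 3).
  have on : odd n.
    apply: contraR nq8; rewrite -dvdn2 => /dvdnP[t Et].
    rewrite (_ : 8 = 2 ^ 3) // -(@eqmod_pow_leq _ 3 _ _ _ (leq_addl _ _) En).
    by rewrite Et mulnC expnM (@expn_mod1 (a ^ 2)) //; apply: odd_sqr_mod8.
  have [m m0 Em] := odd_root_mod2 K oa on; exists m => //.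
  by rewrite -Em -modnXm -(@eqmod_pow_leq _ K _ _ _ (leq_addr _ _) En) modnXm.
have [m m0] := corresponding_power fg gf c3 (n := 1) isT; rewrite expn1 => Em.
have : 3 = 1 %[mod 2 ^ 3].
  apply: (@eqmod_pow_leq _ _ _ _ _ Lq); apply/clq.
  apply/(pclosure_imageP fg gf c2 cq n2q) => //; rewrite Em.
  by apply: pclosure_trans qa _; apply: pclosure_power.
by [].
Qed.

(** Primes [q] with prescribed valuation show that [f] maps the progression of level [k] onto one of
    some level [j >= k0]. By induction [j >= k]: otherwise [1 + p^(k-1)], whose image is known to be
    1 modulo [p'^(k-1)], would lie in the progression of level [k]. *)
Lemma eqmod1_image f g p p' k0 : arith_homeo f g -> arith_homeo g f ->
  corresponding f p p' -> lte_exponent p <= k0 -> lte_exponent p' <= k0 ->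
  (forall q q', corresponding f q q' -> k0 <= logn p (q - 1) -> k0 <= logn p' (q' - 1)) ->
  forall k x, k0 <= k -> 0 < x -> x = 1 %[mod p ^ k] -> f x = 1 %[mod p' ^ k].
Proof.
move=> fg gf cp Lp Lp' H; have [pp pp' _] := cp.
have key k : k0 <= k -> exists2 j, k0 <= j &
    forall x, 0 < x -> x = 1 %[mod p ^ k] <-> f x = 1 %[mod p' ^ j].
  move=> k0k; have Lk := leq_trans Lp k0k.
  have [q prq Eq] := exists_prime_logn pp Lk.
  have [q' cq] := arith_homeo_prime fg prq; have [_ prq' _] := cq.
  have k0j : k0 <= logn p' (q' - 1) by apply: (H _ _ cq); rewrite Eq.
  have npq : p <> q.
    by apply: (logn_sub1_neq pp); rewrite Eq (leq_trans _ Lk) // lte_exponent_gt0.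
  exists (logn p' (q' - 1)) => // x x0; rewrite -Eq -pclosure_logn ?Eq ?prime_gt1 //.
  rewrite (pclosure_imageP fg gf cp cq npq x0).
  by apply: pclosure_logn; rewrite ?prime_gt1 // (leq_trans Lp').
move=> k x k0k; elim: k k0k x => [|k IH] k0k x x0 Ex.
  by rewrite expn0 !modn1.
have [j k0j Hj] := key _ k0k.
case: (ltnP k j) => [kj|jk]; first by apply: eqmod_pow_leq kj _; apply/Hj.
have k0k' : k0 <= k by apply: leq_trans jk.
have : 1 + p ^ k = 1 %[mod p ^ k.+1].
  apply/Hj => //; apply: eqmod_pow_leq jk _; apply: IH => //.
  by rewrite modnDr.
move/eqP; rewrite eqmod1 // addKn dvdn_Pexp2l ?prime_gt1 //.
by rewrite ltnn.
Qed.

Lemma corresponding_neq2 f g p r : arith_homeo f g -> arith_homeo g f ->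
  corresponding f p r -> p != 2 -> r != 2.
Proof.
move=> fg gf c; apply: contra => /eqP E; rewrite E in c; apply/eqP.
exact: (corresponding2 gf fg (corresponding_sym gf c)).
Qed.

Lemma eqmod1_image_odd f g p r k x : arith_homeo f g -> arith_homeo g f ->
  corresponding f p r -> p != 2 -> 0 < x -> x = 1 %[mod p ^ k] -> f x = 1 %[mod r ^ k].
Proof.
move=> fg gf c p2; have r2 := corresponding_neq2 fg gf c p2; have [pp pr _] := c.
case: k => [|k]; first by rewrite !expn0 !modn1.
apply: (eqmod1_image fg gf c (k0 := 1)) => //; try by apply: lte_exponent_le.
move=> q q' cq Lq; have [_ pq' _] := cq; rewrite -eqmod1_logn ?prime_gt1 //.
rewrite expn1 eqmod1 ?prime_gt0 //; apply: (image_prime_eqmod1 fg gf c cq r2).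
exact: lte_exponent_le.
Qed.

Lemma eqmod1_image2 f g k x : arith_homeo f g -> arith_homeo g f ->
  corresponding f 2 2 -> 3 <= k -> 0 < x -> x = 1 %[mod 2 ^ k] -> f x = 1 %[mod 2 ^ k].
Proof.
move=> fg gf c; apply: (eqmod1_image fg gf c (k0 := 3)) => // q q' cq Lq.
have [_ pq' _] := cq; rewrite -eqmod1_logn ?prime_gt1 //; apply/eqP.
exact: image_prime_eqmod8 fg gf c cq Lq.
Qed.

(** The one-sided transfer is applied to [f] and to [g]. For the prime 2 it starts at modulus 8;
    modulus 4 has to wait for [arith_homeo5]. *)
Lemma dvdn_image_sub1 f g p r k x : arith_homeo f g -> arith_homeo g f ->
  corresponding f p r -> (p != 2) || (2 < k) -> 0 < x ->
  (p ^ k %| x - 1) = (r ^ k %| f x - 1).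
Proof.
move=> fg gf c p2k x0; have fx0 := arith_homeo_gt0 fg x0.
have gfx := arith_homeo_can fg x0; have c' := corresponding_sym gf c.
rewrite -!eqmod1 //; case: (boolP (p == 2)) p2k => [/eqP E|p2 _] /=.
  have r2 : r = 2 by move: c; rewrite E; apply: corresponding2 fg gf.
  rewrite E r2 in c c' * => k2.
  by apply/eqP/eqP => H; [|rewrite -gfx]; apply: eqmod1_image2 H => //; eassumption.
have r2 := corresponding_neq2 fg gf c p2.
apply/eqP/eqP => H; first exact: (eqmod1_image_odd fg gf c p2 x0 H).
by rewrite -gfx; apply: (eqmod1_image_odd gf fg c' r2 fx0 H).
Qed.

(** * Small values and the induction for fixed points *)

Section Rigid.
Variables f g : nat -> nat.
Hypotheses (fg : arith_homeo f g) (gf : arith_homeo g f).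

Let f0 x : 0 < x -> 0 < f x. Proof. exact: (arith_homeo_gt0 fg). Qed.
Let fK x : 0 < x -> g (f x) = x. Proof. exact: (arith_homeo_can fg). Qed.

Lemma arith_homeo1 : f 1 = 1.
Proof.
apply/eqP; rewrite eqn_leq f0 // andbT leqNgt; apply/negP => f1.
have [p [_ pp H]] := arith_homeo_prime gf (pdiv_prime f1).
by have := H _ (ltnW f1); rewrite pdiv_dvd fK // (prime_ndvd1 pp).
Qed.

Lemma arith_homeo_gt1 x : 1 < x -> 1 < f x.
Proof.
move=> x1; have x0 := ltnW x1; rewrite ltn_neqAle f0 // andbT eq_sym.
apply/eqP => E; have := fK x0; rewrite E -[X in g X]arith_homeo1 fK // => E1.
by rewrite -E1 in x1.
Qed.

Let c2 : corresponding f 2 2.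
Proof.
have [r c] := arith_homeo_prime fg (isT : prime 2).
by have E := corresponding2 fg gf c; rewrite E in c.
Qed.

Let even_image x : 0 < x -> odd (f x) = odd x.
Proof. by move=> x0; apply: negb_inj; rewrite -!dvdn2; case: c2 => _ _ /(_ _ x0). Qed.

Lemma image_pow2_sub1 x j : 1 < x -> x - 1 = 2 ^ j -> exists i, f x - 1 = 2 ^ i.
Proof.
move=> x1 Ex; have x0 := ltnW x1; have fx1 := arith_homeo_gt1 x1.
suff /p_natP[i ->] : 2.-nat (f x - 1) by exists i.
apply/pnatP; first by rewrite subn_gt0.
move=> r pr rf; rewrite inE /=; apply/negPn/negP => r2.
have [p c] := exists_preimage fg gf pr; have [pp _ _] := c.
have p2 : p != 2.
  apply: contra r2 => /eqP E; rewrite E in c.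
  exact/eqP/(corresponding_inj gf c c2).
have := dvdn_image_sub1 (k := 1) fg gf c _ x0; rewrite p2 !expn1 rf Ex.
by move/(_ isT); rewrite Euclid_dvdX // dvdn_prime2 // (negbTE p2).
Qed.

(** For [x] equal to 3 or 5, [f x - 1] is a power of 2, even and not divisible by 8, so [f] permutes
    3 and 5. From [4 - 1 = 3] follows [f 4 = 1 + s] with [s] corresponding to 3; a swap would give
    [s = 5] and [f 4 = 6], not a power of 2. *)
Lemma arith_homeo5 : f 5 = 5.
Proof.
have not8 x : 0 < x -> ~~ (8 %| x - 1) -> ~~ (8 %| f x - 1).
  by move=> x0; rewrite (@dvdn_image_sub1 f g 2 2 3 x).
have [s c3] := arith_homeo_prime fg (isT : prime 3); have [_ ps H3] := c3.
have s2 := corresponding_neq2 fg gf c3 isT.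
have f35 x : x - 1 = 2 \/ x - 1 = 4 -> f x = 3 \/ f x = 5.
  move=> Ex; have x1 : 1 < x by lia.
  have [i Ei] : exists i, f x - 1 = 2 ^ i.
    by case: Ex => Ex; [apply: (@image_pow2_sub1 x 1)|apply: (@image_pow2_sub1 x 2)].
  have := not8 x (ltnW x1); rewrite Ei.
  have -> : ~~ (8 %| x - 1) by case: Ex => ->.
  move/(_ isT); rewrite (_ : 8 = 2 ^ 3) // dvdn_Pexp2l // -ltnNge.
  have := even_image (ltnW x1); have -> : odd x by case: Ex => Ex; lia.
  have fx1 := arith_homeo_gt1 x1.
  move: Ei; case: i => [|[|[|]]] // Ei ofx _; first by move: ofx; have -> : f x = 2 by lia.
    by left; lia.
  by right; lia.
have f4 : f 4 = 1 + s.
  have f41 : 1 < f 4 by apply: arith_homeo_gt1.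
  have : s.-nat (f 4 - 1).
    apply/pnatP; first by rewrite subn_gt0.
    move=> r pr rf; rewrite inE /=; apply/eqP.
    have [p c] := exists_preimage fg gf pr; have [pp _ _] := c.
    have p2 : p != 2.
      apply/eqP => E; rewrite E in c; move: rf; rewrite (corresponding_inj gf c c2).
      by rewrite dvdn2 oddB ?even_image // ltnW.
    have := dvdn_image_sub1 (x := 4) (k := 1) fg gf c _ isT; rewrite p2 !expn1 rf.
    move/(_ isT); rewrite (dvdn_prime2 pp (isT : prime 3)) => /eqP E; rewrite E in c.
    exact: (corresponding_inj gf c c3).
  case/p_natP => i Ei.
  have D k := dvdn_image_sub1 (x := 4) (k := k) fg gf c3 isT isT.
  rewrite Ei in D; have := D 1; have := D 2.
  rewrite !(dvdn_Pexp2l _ _ (prime_gt1 ps)).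
  move: Ei; case: (i) => [|[|]] // Ei _ _.
  by rewrite -[s in RHS]expn1 -Ei subnKC // ltnW.
have f3 : f 3 = 3.
  case: (f35 3); [by left|by []|] => E5.
  have := H3 3 isT; rewrite E5 (dvdn_prime2 ps (isT : prime 5)) => /esym/eqP Es.
  have [m _] := corresponding_power fg gf c2 (n := 2) isT.
  rewrite f4 Es => Em; have : 3 %| 2 ^ m by rewrite -Em.
  by rewrite Euclid_dvdX.
case: (f35 5); [by right| |by []] => E3.
by have := fK (isT : 0 < 5); rewrite E3 -[X in g X]f3 fK.
Qed.

(** Beyond parity only modulus 4 is new: [1 + 4 N] is the 2-adic closure of the powers of 5, and 5
    corresponds to itself. *)
Lemma dvdn_image p r k x : corresponding f p r -> 0 < x ->
  (p ^ k %| x - 1) = (r ^ k %| f x - 1).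
Proof.
move=> c x0; case: (boolP ((p != 2) || (2 < k))) => [pk|].
  exact: (dvdn_image_sub1 fg gf c pk x0).
rewrite negb_or negbK -leqNgt => /andP[/eqP E k2]; rewrite E in c *.
rewrite (corresponding_inj gf c c2) -!eqmod1 ?f0 //.
case: k k2 => [|[|[|]]] // _; first by rewrite !expn0 !modn1.
  by rewrite !expn1 !modn2 even_image.
have [s c5] := arith_homeo_prime fg (isT : prime 5); have [_ ps H5] := c5.
have Es : s = 5.
  have := H5 5 isT; rewrite arith_homeo5 (dvdn_prime2 ps (isT : prime 5)).
  by move/esym/eqP.
rewrite Es in c5.
have cl y : pclosure 2 5 y <-> y = 1 %[mod 2 ^ 2] by apply: (@pclosure_logn 2 5).
have I := pclosure_imageP fg gf c2 c5 (y := x).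
by apply/eqP/eqP => /cl H; apply/cl; apply/I.
Qed.

(** Primes dividing [x - 1] are below [x], so by induction they are fixed and correspond to
    themselves; hence [x - 1] and [f x - 1] have equal valuations. *)
Lemma arith_homeo_id x : 0 < x -> f x = x.
Proof.
elim/ltn_ind: x => x IH x0.
case: (ltnP 1 x) => [x1|]; last first.
  by move=> x1; rewrite (_ : x = 1) ?arith_homeo1 //; lia.
have fx1 := arith_homeo_gt1 x1.
have sx : 0 < x - 1 by rewrite subn_gt0.
have sfx : 0 < f x - 1 by rewrite subn_gt0.
suff E : f x - 1 = x - 1 by rewrite -[RHS](subnK x0) -E subnK // ltnW.
have fixed p r : corresponding f p r -> p %| x - 1 -> r = p.
  move=> [pp pr H] /(dvdn_leq sx) le; have p0 := prime_gt0 pp.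
  have := H p p0; rewrite IH //; last by lia.
  by rewrite dvdnn => /esym; rewrite dvdn_prime2 // => /eqP.
apply: eqn_from_log => // p.
case: (boolP (prime p)) => [pp|npp]; last by rewrite lognE (negbTE npp) /= lognE (negbTE npp).
apply/eqP; rewrite eqn_leq; apply/andP; split.
  case: (posnP (logn p (f x - 1))) => [-> //|l0].
  have [p0 c] := exists_preimage fg gf pp; have [pp0 _ _] := c.
  have D : p0 ^ logn p (f x - 1) %| x - 1 by rewrite (dvdn_image _ c) // pfactor_dvdn.
  have E : p = p0.
    by apply: (fixed _ _ c); apply: dvdn_trans D; apply: dvdn_exp.
  by rewrite -pfactor_dvdn // {1}E.
case: (posnP (logn p (x - 1))) => [-> //|l0].
have [r c] := arith_homeo_prime fg pp.
have D : p ^ logn p (x - 1) %| x - 1 by rewrite pfactor_dvdn.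
have E : r = p by apply: (fixed _ _ c); apply: dvdn_trans D; apply: dvdn_exp.
by rewrite -pfactor_dvdn // -{1}E -(dvdn_image _ c).
Qed.
End Rigid.

(** * Closures in the Golomb topology *)

Definition golomb_closure (U : posnat -> Prop) (w : posnat) : Prop :=
  forall V, golomb_open V -> V w -> exists2 z, V z & U z.

(* [A] belongs to the filter generated by the closures of the neighbourhoods of the points. *)
Definition closure_filter (x y z : posnat) (A : posnat -> Prop) : Prop :=
  exists U V W : posnat -> Prop,
    [/\ golomb_open U, golomb_open V & golomb_open W] /\ [/\ U x, V y & W z] /\
    forall w, golomb_closure U w -> golomb_closure V w -> golomb_closure W w -> A w.

Definition progression (x : posnat) (d : nat) : posnat -> Prop := arith_prog (val x) d.

Lemma progression_self x d : progression x d x.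
Proof. by exists 0; rewrite muln0 addn0. Qed.

Lemma progression_open x d : 0 < d -> coprime (val x) d -> golomb_open (progression x d).
Proof.
move=> d0 co y [n En]; exists (val y), d; split; last first.
  split; first exact: progression_self.
  by move=> z [m Em]; exists (n + m); rewrite Em (En : val y = _) mulnDr addnA.
split; first exact: valP y.
by split=> //; rewrite (En : val y = _) /coprime -gcdn_modl addnC mulnC modnMDl gcdn_modl.
Qed.

Lemma open_progression U x : golomb_open U -> U x ->
  exists d, [/\ 0 < d, coprime (val x) d & forall y, progression x d y -> U y].
Proof.
move=> oU /oU [a [d [[a0 [d0 co]] [[n En] sub]]]]; exists d; split=> //.
  by rewrite (En : val x = _) /coprime -gcdn_modl addnC mulnC modnMDl gcdn_modl.
move=> y [m Em]; apply: sub; exists (n + m).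
by rewrite Em (En : val x = _) mulnDr addnA.
Qed.

(** Progressions are one-sided, so their members must be sought above a bound. *)
Lemma exists_posnat_mod (a d N : nat) : 0 < d -> exists2 z : posnat, N <= val z &
  val z = a %[mod d].
Proof.
move=> d0; have z0 : 0 < a + (N.+1) * d.
  by rewrite addn_gt0 muln_gt0 d0 orbT.
exists (exist (fun n => 0 < n) _ z0) => /=; last by rewrite addnC modnMDl.
by rewrite (leq_trans (leqnSn N)) // (leq_trans _ (leq_addl _ _)) // leq_pmulr.
Qed.

Lemma eqmod_progression (x y : posnat) d : val x <= val y ->
  val y = val x %[mod d] -> progression x d y.
Proof.
move=> le /eqP; rewrite eqn_mod_dvd // => /dvdnP[n En]; exists n.
by rewrite mulnC -En subnKC.
Qed.

Lemma progression_eqmod (x y : posnat) d : progression x d y -> val y = val x %[mod d].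
Proof. by case=> n En; rewrite (En : val y = _) addnC mulnC modnMDl. Qed.

(** The Chinese remainder theorem for moduli with a common factor; dividing by it leaves a linear
    congruence with coprime coefficient and modulus. *)
Lemma exists_eqmod2 (a b m n : nat) : 0 < m -> 0 < n -> a = b %[mod gcdn m n] ->
  exists t, t = a %[mod m] /\ t = b %[mod n].
Proof.
move=> m0 n0 Eab; set d := gcdn m n in Eab; have d0 : 0 < d by rewrite gcdn_gt0 m0.
have [c Ec] : exists c, b + a * n = a + c * d.
  have le : a <= b + a * n by rewrite (leq_trans _ (leq_addl _ _)) // leq_pmulr.
  have /dvdnP[c Ec] : d %| b + a * n - a.
    rewrite -eqn_mod_dvd // -(divnK (dvdn_gcdr m n)) mulnA addnC modnMDl.
    by rewrite eq_sym; apply/eqP.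
  by exists c; rewrite -Ec subnKC.
have /dvdnP[m' Em] : d %| m by apply: dvdn_gcdl.
have /dvdnP[n' En] : d %| n by apply: dvdn_gcdr.
have [|s Es] := @solve_mod m' c n'.
  by rewrite /coprime -(eqn_pmul2r d0) muln_gcdl -Em -En mul1n.
exists (a + s * m); split; first by rewrite addnC modnMDl.
rewrite -[RHS](modnMDl a) [a * n + b]addnC Ec; apply/eqP; rewrite eqn_modDl; apply/eqP.
have -> : s * m = m' * s * d by rewrite Em mulnA [s * _]mulnC.
by rewrite En -!muln_modl Es.
Qed.

(** A basic neighbourhood of [w] has a modulus [e] prime to [w], and meets the progression of [x]
    exactly when [w] and [x] agree modulo [gcdn e d]. *)
Lemma closure_progressionP x d w : 0 < d ->
  golomb_closure (progression x d) w <->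
  (forall e, e %| d -> coprime e (val w) -> val w = val x %[mod e]).
Proof.
move=> d0; split=> [H e ed co|H V oV Vw].
  have e0 : 0 < e by apply: dvdn_gt0 ed.
  have [] := H (progression w e) _ (progression_self _ _).
    by apply: progression_open; rewrite // coprime_sym.
  move=> z /progression_eqmod <- /progression_eqmod.
  exact: eqmod_dvd_trans.
have [e [e0 co sub]] := open_progression oV Vw.
have [t [tw tx]] : exists t, t = val w %[mod e] /\ t = val x %[mod d].
  apply: exists_eqmod2 => //; apply: H; first exact: dvdn_gcdr.
  by rewrite coprime_sym; apply: coprime_dvdr co; apply: dvdn_gcdl.
have [|z zN zt] := @exists_posnat_mod t (e * d) (val x + val w).
  by rewrite muln_gt0 e0.
exists z.
  apply/sub/eqmod_progression; first by apply: leq_trans zN; apply: leq_addl.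
  by rewrite -tw; apply: eqmod_dvd_trans zt; apply: dvdn_mulr.
apply/eqmod_progression; first by apply: leq_trans zN; apply: leq_addr.
by rewrite -tx; apply: eqmod_dvd_trans zt; apply: dvdn_mull.
Qed.

Lemma closure_sub (U V : posnat -> Prop) w : (forall y, U y -> V y) ->
  golomb_closure U w -> golomb_closure V w.
Proof. by move=> UV H S oS Sw; have [z Sz /UV] := H S oS Sw; exists z. Qed.

Lemma closure_progression_eqmod x d w e : 0 < d -> golomb_closure (progression x d) w ->
  e %| d -> coprime e (val w) -> val w = val x %[mod e].
Proof. by move=> d0 /(closure_progressionP _ _ d0); apply. Qed.

(** A divisor of [d] prime to [w] can only be a power of [p]. *)
Lemma closure_progression_local p x d w : prime p -> 0 < d ->
  (forall q, prime q -> q != p -> q %| d -> q %| val w) ->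
  (~~ (p %| val w) -> val w = val x %[mod p ^ logn p d]) ->
  golomb_closure (progression x d) w.
Proof.
move=> pp d0 Hq Hp; apply/closure_progressionP => // e ed co.
have e0 : 0 < e by apply: dvdn_gt0 ed.
have /p_natP[j Ej] : p.-nat e.
  apply/pnatP => // q pq qe; rewrite inE /=; apply/negPn/negP => qp.
  have qw : q %| val w by apply: Hq => //; apply: dvdn_trans ed.
  have : q %| gcdn e (val w) by rewrite dvdn_gcd qe.
  by rewrite (eqP co) (prime_ndvd1 pq).
case: j Ej => [|j] Ej; first by rewrite Ej expn0 !modn1.
rewrite Ej; apply: (@eqmod_dvd_trans _ _ _ (p ^ logn p d)).
  by rewrite dvdn_exp2l // -pfactor_dvdn // -Ej.
by apply: Hp; rewrite -prime_coprime //; move: co; rewrite Ej coprime_pexpl.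
Qed.

(** The largest divisor of [M ^ K] that is an admissible modulus at [x]; [M] supplies the primes and
    [K] the precision. *)
Definition prime_to_part (x : posnat) (M K : nat) : nat := (M ^ K)`_(\pi(val x)^').

Lemma prime_to_part_gt0 x M K : 0 < prime_to_part x M K.
Proof. exact: part_gt0. Qed.

Lemma coprime_prime_to_part x M K : coprime (val x) (prime_to_part x M K).
Proof.
apply: (@pnat_coprime \pi(val x)); last exact: part_pnat.
by apply: pnat_pi; apply: valP x.
Qed.

Lemma prime_to_part_open x M K : golomb_open (progression x (prime_to_part x M K)).
Proof. exact/progression_open/coprime_prime_to_part/prime_to_part_gt0. Qed.

Lemma pfactor_prime_to_part p x M K : prime p -> 0 < M -> p %| M -> ~~ (p %| val x) ->
  p ^ K %| prime_to_part x M K.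
Proof.
move=> pp M0 pM px; have MK0 : 0 < M ^ K by rewrite expn_gt0 M0.
have pid : (\pi(val x)^').-nat (p ^ K).
  by rewrite pnatX pnatE // !inE /= mem_primes pp (valP x) (negbTE px).
by rewrite -(part_pnat_id pid) partn_dvd // dvdn_exp2r.
Qed.

(** Otherwise [w] agrees with both [x] and [y] modulo [p ^ K], which exceeds both, so [x = y]. *)
Lemma closures_separate p x y M K w : prime p -> 0 < M -> p %| M ->
  x <> y -> val x + val y <= K -> ~~ (p %| val x) -> ~~ (p %| val y) ->
  golomb_closure (progression x (prime_to_part x M K)) w ->
  golomb_closure (progression y (prime_to_part y M K)) w -> p %| val w.
Proof.
move=> pp M0 pM nxy le px py cx cy; apply/negPn/negP => pw; apply: nxy; apply: val_inj.
have co : coprime (p ^ K) (val w) by rewrite coprimeXl // prime_coprime.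
have Ex := closure_progression_eqmod (prime_to_part_gt0 _ _ _) cx
             (pfactor_prime_to_part _ pp M0 pM px) co.
have Ey := closure_progression_eqmod (prime_to_part_gt0 _ _ _) cy
             (pfactor_prime_to_part _ pp M0 pM py) co.
have lK : K < p ^ K by apply: ltn_expl; apply: prime_gt1.
move: Ey; rewrite Ex !modn_small //; apply: leq_ltn_trans lK; apply: leq_trans le.
  exact: leq_addl.
exact: leq_addr.
Qed.

(** * Filters of triples of points *)

Definition maximal_filter (x y z : posnat) : Prop :=
  forall A a b c, closure_filter a b c A -> closure_filter x y z A.

Lemma closure_filter_progressions x y z A : closure_filter x y z A ->
  exists d1 d2 d3, [/\ [/\ 0 < d1, 0 < d2 & 0 < d3],
    [/\ coprime (val x) d1, coprime (val y) d2 & coprime (val z) d3] &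
    forall w, golomb_closure (progression x d1) w -> golomb_closure (progression y d2) w ->
      golomb_closure (progression z d3) w -> A w].
Proof.
case=> U [V [W [[oU oV oW] [[Ux Vy Wz] H]]]].
have [d1 [d10 c1 s1]] := open_progression oU Ux.
have [d2 [d20 c2 s2]] := open_progression oV Vy.
have [d3 [d30 c3 s3]] := open_progression oW Wz.
exists d1, d2, d3; split=> // w w1 w2 w3.
by apply: H; [exact: closure_sub w1|exact: closure_sub w2|exact: closure_sub w3].
Qed.

(** A prime factor of [M] divides at most one of the points, and the other two force it to divide
    [w]. Then no divisor of [M] except 1 is prime to [w], so [w] is in the closure of every
    progression with modulus dividing [M]. *)
Lemma maximal_filter_coprime3 x y z : x <> y -> x <> z -> y <> z ->
  coprime (val x) (val y) -> coprime (val x) (val z) -> coprime (val y) (val z) ->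
  maximal_filter x y z.
Proof.
move=> nxy nxz nyz cxy cxz cyz A a b c.
case/closure_filter_progressions=> d1 [d2 [d3 [[d10 d20 d30] _ H]]].
set M := d1 * d2 * d3; have M0 : 0 < M by rewrite !muln_gt0 d10 d20.
set K := val x + val y + val z.
exists (progression x (prime_to_part x M K)), (progression y (prime_to_part y M K)),
  (progression z (prime_to_part z M K)).
split; first by split; apply: prime_to_part_open.
split; first by split; apply: progression_self.
move=> w wx wy wz.
have one u v p : coprime (val u : nat) (val v) -> prime p -> p %| val u -> ~~ (p %| val v).
  move=> co pp pu; apply/negP => pv.
  have : p %| gcdn (val u) (val v) by rewrite dvdn_gcd pu.
  by rewrite (eqP co) (prime_ndvd1 pp).
have all_p p : prime p -> p %| M -> p %| val w.
  move=> pp pM; case: (boolP (p %| val x)) => px.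
    apply: (closures_separate pp M0 pM nyz _ _ _ wy wz).
    - by rewrite /K -addnA leq_addl.
    - exact: one cxy pp px.
    - exact: one cxz pp px.
  case: (boolP (p %| val y)) => py.
    apply: (closures_separate pp M0 pM nxz _ px _ wx wz).
    - by rewrite /K addnAC leq_addr.
    - exact: one cyz pp py.
  by apply: (closures_separate pp M0 pM nxy _ px py wx wy); rewrite /K leq_addr.
have cl u d : 0 < d -> d %| M -> golomb_closure (progression u d) w.
  move=> d0 dM; apply/closure_progressionP => // e ed co.
  suff -> : e = 1 by rewrite !modn1.
  have e0 : 0 < e by apply: dvdn_gt0 ed.
  apply/eqP; rewrite eqn_leq e0 andbT leqNgt; apply/negP => e1.
  have pe := pdiv_prime e1; have de := pdiv_dvd e.
  have : pdiv e %| gcdn e (val w).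
    by rewrite dvdn_gcd de all_p // (dvdn_trans de) // (dvdn_trans ed).
  by rewrite (eqP co) (prime_ndvd1 pe).
apply: H; apply: cl => //.
- by rewrite /M -mulnA dvdn_mulr.
- by rewrite /M mulnAC dvdn_mull.
- by rewrite /M dvdn_mull.
Qed.

Lemma exists_local_witness p D K a : prime p -> 0 < D ->
  exists2 w : posnat, val w = a %[mod p ^ K] &
    forall q, prime q -> q != p -> q %| D -> q %| val w.
Proof.
move=> pp D0; have [m cm Em] := pfactor_coprime pp D0.
have m0 : 0 < m by move: D0; rewrite Em; case: (m).
have co : coprime (p ^ K) m by rewrite coprimeXl.
have ta := chinese_modl co a 0; have tm := chinese_modr co a 0.
set t := chinese _ _ _ _ in ta tm.
have [|w _ Ew] := @exists_posnat_mod t (p ^ K * m) 0.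
  by rewrite muln_gt0 expn_gt0 prime_gt0.
exists w; first by rewrite -ta; apply: eqmod_dvd_trans Ew; apply: dvdn_mulr.
move=> q pq qp qD; have qm : q %| m.
  move: qD; rewrite Em Euclid_dvdM // => /orP[//|].
  by rewrite Euclid_dvdX // dvdn_prime2 // (negbTE qp).
apply: dvdn_trans qm _; rewrite /dvdn.
have -> : val w = t %[mod m] by apply: eqmod_dvd_trans Ew; apply: dvdn_mull.
by rewrite tm mod0n.
Qed.

Definition posnat_of (n : nat) (n0 : 0 < n) : posnat := exist (fun n => 0 < n) n n0.

Lemma coprime_logn0 p x d : prime p -> p %| x -> coprime x d -> logn p d = 0.
Proof. by move=> pp px co; apply: logn_coprime; apply: coprime_dvdl co. Qed.

Lemma eqmod_ndvd p K a b : prime p -> 0 < K -> a = b %[mod p ^ K] -> (p %| a) = (p %| b).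
Proof.
move=> pp K0 E; have Ep : a = b %[mod p].
  by apply: eqmod_dvd_trans E; apply: dvdn_exp.
by rewrite /dvdn Ep.
Qed.

(** If [p] divides [x] and [y], neighbourhoods of these two points impose nothing at [p], so the
    multiples of [p] are not in the filter; yet another triple has them in its filter. *)
Lemma maximal_filter_coprime x y z : maximal_filter x y z -> coprime (val x) (val y).
Proof.
move=> max; apply/negPn/negP => nco.
have g1 : 1 < gcdn (val x) (val y).
  by rewrite ltn_neqAle eq_sym nco gcdn_gt0 (valP x).
have pp := pdiv_prime g1; have := pdiv_dvd (gcdn (val x) (val y)).
set p := pdiv _ in pp *; rewrite dvdn_gcd => /andP[px py].
(* The points 1 and [p + 1] are prime to [p] and distinct modulo [p ^ 2], also for [p = 2]. *)
pose one := posnat_of (isT : 0 < 1); pose two := posnat_of (isT : 0 < p.+1).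
have p2 : 0 < p ^ 2 by rewrite expn_gt0 prime_gt0.
have : closure_filter x y z (fun w => p %| val w).
  apply: (max _ one two one); exists (progression one (p ^ 2)), (progression two (p ^ 2)),
    (progression one 1); split.
    split; apply: progression_open => //.
    - exact: coprime1n.
    - by rewrite coprimeXr // coprimeSn.
  split; first by split; apply: progression_self.
  move=> w w1 w2 _; apply/negPn/negP => pw.
  have co : coprime (p ^ 2) (val w) by rewrite coprimeXl // prime_coprime.
  have E1 := closure_progression_eqmod p2 w1 (dvdnn _) co.
  have := closure_progression_eqmod p2 w2 (dvdnn _) co.
  have p1 := prime_gt1 pp; have pS : p.+1 < p ^ 2 by rewrite -mulnn; nia.
  rewrite E1 /= !modn_small //; last by apply: leq_trans pS.
  by case=> E; rewrite -E in p1.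
case/closure_filter_progressions=> d1 [d2 [d3 [[d10 d20 d30] [c1 c2 c3] H]]].
(* A residue prime to [p] that meets the only possible condition at [p], the one from [z]. *)
pose a := if p %| val z then 1 else val z.
have pa : ~~ (p %| a) by rewrite /a; case: ifPn => //; rewrite (prime_ndvd1 pp).
have [|w Ew Hw] := @exists_local_witness p (d1 * d2 * d3) (logn p d3).+1 a pp.
  by rewrite !muln_gt0 d10 d20.
have npw : ~~ (p %| val w) by rewrite (eqmod_ndvd pp _ Ew).
case/negP: npw; apply: H; apply: (closure_progression_local pp) => //.
- by move=> q pq qp qd; apply: Hw; rewrite // -mulnA dvdn_mulr.
- by rewrite (coprime_logn0 pp px c1) expn0 !modn1.
- by move=> q pq qp qd; apply: Hw; rewrite // mulnAC dvdn_mull.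
- by rewrite (coprime_logn0 pp py c2) expn0 !modn1.
- by move=> q pq qp qd; apply: Hw; rewrite // dvdn_mull.
move=> _; move: Ew; rewrite /a; case: ifPn => pz Ew.
  by rewrite (coprime_logn0 pp pz c3) expn0 !modn1.
by apply: eqmod_dvd_trans Ew; apply: dvdn_exp2l.
Qed.

(** A prime above [x + y] serves as third point. *)
Lemma coprime_maximal_filter x y : x <> y -> coprime (val x) (val y) ->
  exists z, maximal_filter x y z.
Proof.
move=> nxy co; have [p lp pp] := prime_above (val x + val y).
have far u : val u < p -> u <> posnat_of (prime_gt0 pp) /\ coprime (val u) p.
  move=> up; split=> [E|]; first by move: up; rewrite E ltnn.
  by rewrite coprime_sym prime_coprime // gtnNdvd // (valP u).
have [n1 c1] := far x (leq_ltn_trans (leq_addr _ _) lp).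
have [n2 c2] := far y (leq_ltn_trans (leq_addl _ _) lp).
by exists (posnat_of (prime_gt0 pp)); apply: maximal_filter_coprime3.
Qed.

Definition prime_power_of (p : nat) (u : nat) : Prop :=
  forall q, prime q -> (q %| u) = (q == p).

(** The points [u] and [v] impose nothing at [p] but together make [w] divisible by all other primes
    in the moduli, so only the [p]-part of the modulus at [x] matters. *)
Lemma closure_filter_padic_nbhs p x u v A : prime p -> ~~ (p %| val x) -> u <> v ->
  prime_power_of p (val u) -> prime_power_of p (val v) -> closure_filter x u v A ->
  exists L, forall x' : posnat, ~~ (p %| val x') -> val x' = val x %[mod p ^ L] ->
    closure_filter x' u v A.
Proof.
move=> pp px nuv Hu Hv.
case/closure_filter_progressions=> d1 [d2 [d3 [[d10 d20 d30] [c1 c2 c3] H]]].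
exists (logn p d1) => x' px' Ex'.
set M := d1 * d2 * d3; have M0 : 0 < M by rewrite !muln_gt0 d10 d20.
set K := val u + val v.
have pL : 0 < p ^ logn p d1 by rewrite expn_gt0 prime_gt0.
exists (progression x' (p ^ logn p d1)), (progression u (prime_to_part u M K)),
  (progression v (prime_to_part v M K)).
split.
  split; try exact: prime_to_part_open.
  by apply: progression_open; rewrite // coprime_sym coprimeXl // prime_coprime.
split; first by split; apply: progression_self.
move=> w wx wu wv.
have all_q q : prime q -> q != p -> q %| M -> q %| val w.
  move=> pq qp qM; apply: (closures_separate pq M0 qM nuv (leqnn _) _ _ wu wv).
    by rewrite Hu.
  by rewrite Hv.
apply: H; apply: (closure_progression_local pp) => //.
- by move=> q pq qp qd; apply: all_q; rewrite // /M -mulnA dvdn_mulr.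
- move=> pw; rewrite -Ex'; apply: (closure_progression_eqmod pL wx (dvdnn _)).
  by rewrite coprimeXl // prime_coprime.
- by move=> q pq qp qd; apply: all_q; rewrite // /M mulnAC dvdn_mull.
- by rewrite (coprime_logn0 pp _ c2) ?expn0 ?modn1 // Hu.
- by move=> q pq qp qd; apply: all_q; rewrite // /M dvdn_mull.
- by rewrite (coprime_logn0 pp _ c3) ?expn0 ?modn1 // Hv.
Qed.

Lemma closure_filter_ball p x u v K : prime p -> ~~ (p %| val x) ->
  closure_filter x u v (fun w => ~~ (p %| val w) -> val w = val x %[mod p ^ K]).
Proof.
move=> pp px; have pK : 0 < p ^ K by rewrite expn_gt0 prime_gt0.
exists (progression x (p ^ K)), (progression u 1), (progression v 1); split.
  split; apply: progression_open => //; try exact: coprimen1.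
  by rewrite coprime_sym coprimeXl // prime_coprime.
split; first by split; apply: progression_self.
move=> w wx _ _ pw; apply: (closure_progression_eqmod pK wx (dvdnn _)).
by rewrite coprimeXl // prime_coprime.
Qed.

Lemma closure_filter_ball_inv p a x u v K : prime p -> ~~ (p %| val x) ->
  p %| val u -> p %| val v ->
  closure_filter x u v (fun w => ~~ (p %| val w) -> val w = a %[mod p ^ K]) ->
  val x = a %[mod p ^ K].
Proof.
move=> pp px pu pv.
case/closure_filter_progressions=> d1 [d2 [d3 [[d10 d20 d30] [c1 c2 c3] H]]].
(* The exponent covers the target precision and the modulus at [x], and is positive so that [w] is
   prime to [p]. *)
have [|w Ew Hw] := @exists_local_witness p (d1 * d2 * d3) (K + logn p d1).+1 (val x) pp.
  by rewrite !muln_gt0 d10 d20.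
have npw : ~~ (p %| val w) by rewrite (eqmod_ndvd pp _ Ew).
have EwK j : j <= (K + logn p d1).+1 -> val w = val x %[mod p ^ j].
  by move=> le; apply: eqmod_dvd_trans Ew; apply: dvdn_exp2l.
rewrite -EwK; last by rewrite leqW // leq_addr.
apply: H npw; apply: (closure_progression_local pp) => //.
- by move=> q pq qp qd; apply: Hw; rewrite // -mulnA dvdn_mulr.
- by move=> _; apply: EwK; rewrite leqW // leq_addl.
- by move=> q pq qp qd; apply: Hw; rewrite // mulnAC dvdn_mull.
- by rewrite (coprime_logn0 pp pu c2) expn0 !modn1.
- by move=> q pq qp qd; apply: Hw; rewrite // dvdn_mull.
- by rewrite (coprime_logn0 pp pv c3) expn0 !modn1.
Qed.

(** * From homeomorphisms to arithmetic maps of the natural numbers *)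

Definition on_nat (h : posnat -> posnat) (n : nat) : nat :=
  if insub n is Some x then val (h x) else 0.

Lemma on_natE h (x : posnat) : on_nat h (val x) = val (h x).
Proof. by rewrite /on_nat valK. Qed.

Lemma posnat_valP (n : nat) : 0 < n -> exists x : posnat, n = val x.
Proof. by move=> n0; exists (posnat_of n0). Qed.

Lemma on_nat_gt0 h n : 0 < n -> 0 < on_nat h n.
Proof. by case/posnat_valP => x ->; rewrite on_natE (valP (h x)). Qed.

Lemma on_natK h g n : cancel h g -> 0 < n -> on_nat g (on_nat h n) = n.
Proof. by move=> hK /posnat_valP[x ->]; rewrite !on_natE hK. Qed.

Definition inverse_homeos (h g : posnat -> posnat) : Prop :=
  [/\ cancel h g, cancel g h, golomb_continuous h & golomb_continuous g].

Lemma inverse_homeos_sym h g : inverse_homeos h g -> inverse_homeos g h.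
Proof. by case. Qed.

Lemma closure_filter_mono x y z (A B : posnat -> Prop) : (forall w, A w -> B w) ->
  closure_filter x y z A -> closure_filter x y z B.
Proof.
move=> AB [U [V [W [o [i H]]]]]; exists U, V, W; split=> //; split=> // w wU wV wW.
exact/AB/H.
Qed.

Lemma closure_filter_image h g x y z A : inverse_homeos h g -> closure_filter x y z A ->
  closure_filter (h x) (h y) (h z) (fun w => A (g w)).
Proof.
move=> [hK _ _ cg] [U [V [W [[oU oV oW] [[Ux Vy Wz] H]]]]].
have cl S w : golomb_closure (fun z => S (g z)) w -> golomb_closure S (g w).
  by move=> HS T oT Tw; have [t Tt St] := HS _ (cg _ oT) Tw; exists (g t).
exists (fun w => U (g w)), (fun w => V (g w)), (fun w => W (g w)).
split; first by split; apply: cg.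
split; first by rewrite !hK.
by move=> w /cl wU /cl wV /cl wW; apply: H.
Qed.

Lemma maximal_filter_image h g x y z : inverse_homeos h g -> maximal_filter x y z ->
  maximal_filter (h x) (h y) (h z).
Proof.
move=> hg max A a b c; have [_ gK _ _] := hg.
move/(closure_filter_image (inverse_homeos_sym hg))/max/(closure_filter_image hg).
by apply: closure_filter_mono => w; rewrite gK.
Qed.

Lemma coprime_image h g m n : inverse_homeos h g -> 0 < m -> 0 < n -> m <> n ->
  coprime m n -> coprime (on_nat h m) (on_nat h n).
Proof.
move=> hg /posnat_valP[x ->] /posnat_valP[y ->] nxy co; rewrite !on_natE.
have [|z max] := coprime_maximal_filter _ co; first by move=> E; apply: nxy; rewrite E.
exact: maximal_filter_coprime (maximal_filter_image hg max).
Qed.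

(** With [a] the image of 1, coprimality of 1 and the preimage of [a * 2] makes [a] coprime to
    [a * 2]. *)
Lemma on_nat1 h g : inverse_homeos h g -> on_nat h 1 = 1.
Proof.
move=> hg; have [_ gK _ _] := hg; set a := on_nat h 1.
have a0 : 0 < a by apply: on_nat_gt0.
have a20 : 0 < a * 2 by rewrite muln_gt0 a0.
have nk : 1 <> on_nat g (a * 2).
  by move=> E; have := on_natK gK a20; rewrite -E -/a; lia.
have := coprime_image hg (ltn0Sn 0) (on_nat_gt0 g a20) nk (coprime1n _).
by rewrite on_natK // /coprime -/a gcdnMr => /eqP.
Qed.

Lemma dvdn_on_nat h g p r z : inverse_homeos h g -> prime p -> prime r ->
  r %| on_nat h p -> 0 < z -> r %| on_nat h z -> p %| z.
Proof.
move=> hg pp pr rp z0 rz; apply/negPn/negP => pz.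
have nz : z <> p by move=> E; rewrite E dvdnn in pz.
have co : coprime z p by rewrite coprime_sym prime_coprime.
have /eqP cofz := coprime_image hg z0 (prime_gt0 pp) nz co.
have : r %| gcdn (on_nat h z) (on_nat h p) by rewrite dvdn_gcd rz.
by rewrite cofz (prime_ndvd1 pr).
Qed.

(** Any prime factor [r] of the image of [p] works: [p] divides the preimage of [r], so the same
    argument applies to the inverse. *)
Lemma exists_corresponding h g p : inverse_homeos h g -> prime p ->
  exists r, corresponding (on_nat h) p r.
Proof.
move=> hg pp; have p0 := prime_gt0 pp; have [hK gK _ _] := hg.
have fp1 : 1 < on_nat h p.
  rewrite ltn_neqAle on_nat_gt0 // andbT; apply/eqP => E.
  have := on_natK hK p0; rewrite -E (on_nat1 (inverse_homeos_sym hg)) => E1.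
  by rewrite -E1 in pp.
set r := pdiv (on_nat h p); have pr : prime r by apply: pdiv_prime.
have rp : r %| on_nat h p by apply: pdiv_dvd.
exists r; split=> // z z0; apply/idP/idP => [pz|rz]; last first.
  exact: (dvdn_on_nat hg pp pr rp z0 rz).
have r0 := prime_gt0 pr.
have pu : p %| on_nat g r.
  by apply: (dvdn_on_nat hg pp pr rp (on_nat_gt0 _ r0)); rewrite on_natK.
apply: (dvdn_on_nat (inverse_homeos_sym hg) pr pp pu (on_nat_gt0 _ z0)).
by rewrite on_natK.
Qed.

(** If the preimage of a prime [q] dividing the image of [u] were prime to [p], it would be coprime
    to [u], making [q] coprime to that image; so [r] divides [q]. *)
Lemma prime_power_image h g p r u : inverse_homeos h g -> corresponding (on_nat h) p r ->
  0 < u -> prime_power_of p u -> prime_power_of r (on_nat h u).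
Proof.
move=> hg [pp pr H] u0 Hu q pq; have q0 := prime_gt0 pq; have [_ gK _ _] := hg.
have ru : r %| on_nat h u by rewrite -H // Hu.
apply/idP/eqP => [qu|-> //].
have kq0 := on_nat_gt0 g q0; set z := on_nat g q in kq0.
have Ez : on_nat h z = q by apply: on_natK.
suff : r %| on_nat h z by rewrite Ez dvdn_prime2 // eq_sym => /eqP.
case: (z =P u) => [-> //|nu]; rewrite -H //.
apply/negPn/negP => npk.
have co : coprime z u.
  rewrite /coprime eqn_leq gcdn_gt0 kq0 andbT leqNgt; apply/negP => g1.
  have ps := pdiv_prime g1; have := pdiv_dvd (gcdn z u).
  rewrite dvdn_gcd => /andP[s1]; rewrite Hu // => /eqP Es.
  by rewrite -Es s1 in npk.
have := coprime_image hg kq0 u0 nu co; rewrite Ez prime_coprime //.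
by rewrite qu.
Qed.

Lemma on_nat_padic_continuous h g p r : inverse_homeos h g ->
  corresponding (on_nat h) p r ->
  forall y, 0 < y -> ~~ (p %| y) -> forall K, exists L, forall x, 0 < x ->
    x = y %[mod p ^ L] -> on_nat h x = on_nat h y %[mod r ^ K].
Proof.
move=> hg c; have [pp pr H] := c => _ /posnat_valP[y ->] py K; have [hK gK _ _] := hg.
have p0 := prime_gt0 pp; have pp0 : 0 < p ^ 2 by rewrite expn_gt0 p0.
(* Two distinct powers of [p] isolate the [p]-adic behaviour at [y]. *)
pose u := posnat_of p0; pose v := posnat_of pp0.
have Hu : prime_power_of p (val u) by move=> q pq; rewrite /= dvdn_prime2.
have Hv : prime_power_of p (val v).
  by move=> q pq; rewrite /= Euclid_dvdX // dvdn_prime2 // andbT.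
have nuv : u <> v.
  by move=> [] /eqP; rewrite -{1}(expn1 p) eqn_exp2l ?prime_gt1.
have ndvd_image w : ~~ (p %| val w) -> ~~ (r %| val (h w)).
  by rewrite -on_natE -H // (valP w).
have hu : prime_power_of r (val (h u)).
  by rewrite -on_natE; apply: (prime_power_image hg c _ Hu).
have hv : prime_power_of r (val (h v)).
  by rewrite -on_natE; apply: (prime_power_image hg c _ Hv).
have := closure_filter_ball (h u) (h v) K pr (ndvd_image y py).
move/(closure_filter_image (inverse_homeos_sym hg)); rewrite !hK.
case/(closure_filter_padic_nbhs pp py nuv Hu Hv) => L HL.
(* [L.+1] keeps [x] prime to [p] even if [L = 0]. *)
exists L.+1 => _ /posnat_valP[x ->] Ex; rewrite !on_natE.
have px : ~~ (p %| val x) by rewrite (eqmod_ndvd pp _ Ex).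
have {}Ex : val x = val y %[mod p ^ L].
  by apply: eqmod_dvd_trans Ex; apply: dvdn_exp2l.
apply: (@closure_filter_ball_inv r _ _ (h u) (h v)); rewrite ?hu ?hv ?ndvd_image //.
apply: closure_filter_mono (closure_filter_image hg (HL x px Ex)) => w.
by rewrite gK.
Qed.

Lemma on_nat_arith_homeo h g : inverse_homeos h g -> arith_homeo (on_nat h) (on_nat g).
Proof.
move=> hg; have [hK _ _ _] := hg; split.
- exact: on_nat_gt0.
- by move=> x; apply: on_natK.
- by move=> p; apply: (exists_corresponding hg).
- by move=> p r; apply: (on_nat_padic_continuous hg).
Qed.

Theorem theorem1p1 (h : posnat -> posnat) :
  golomb_homeomorphism h -> forall x, h x = x.
Proof.
move=> [g [hK [gK [ch cg]]]] x; apply: val_inj; rewrite -on_natE.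
have hg : inverse_homeos h g by [].
apply: (arith_homeo_id (on_nat_arith_homeo hg)); last exact: valP x.
exact: on_nat_arith_homeo (inverse_homeos_sym hg).
Qed.
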